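(* Let $(Q,\mathfrak m_Q,\mathsf k)$ be either a short or a stretched Gorenstein Artin local ring, let $G=\mathrm{gr}(Q)$ and $s=\ell\ell(Q)$. If $s\ge3$, then $\mathrm{edim}(Q)=H_Q(s-1)+\mathrm{type}(G)-1$ and $\dim_{\mathsf k}(\mathrm{soc}(G)\cap\mathfrak m_G^2)=1$. In particular, $G\simeq A\times_{\mathsf k}B$, where $A$ is graded Gorenstein with $\ell\ell(A)=s$, and $B$ is graded with $\ell\ell(B)=1$ (and $s>\ell\ell(B)+1=2$).
   Context: For an Artinian local ring $(T,\mathfrak m,\mathsf k)$: $\mathrm{edim}(T)$ is the minimal number of generators of $\mathfrak m$, $\mathrm{soc}(T)=\mathrm{ann}_T(\mathfrak m)$, $\mathrm{type}(T)=\dim_{\mathsf k}\mathrm{soc}(T)$, and the Loewy length is $\ell\ell(T)=\max\{n:\mathfrak m^n\ne0\}$. $\mathrm{gr}(T)=\bigoplus_{i\ge0}\mathfrak m^i/\mathfrak m^{i+1}$ is the associated graded ring, and $H_T(i)=\dim_{\mathsf k}(\mathfrak m^i/\mathfrak m^{i+1})$; for $\ell\ell(T)=s$ we write $H_T=(H_T(0),\ldots,H_T(s))$. The same notation is used for Artinian graded $\mathsf k$-algebras with their homogeneous maximal ideal; $\mathfrak m_G$ is the homogeneous maximal ideal of $G$. A Gorenstein Artin local ring $T$ is stretched if $H_T=(1,h,1,\ldots,1)$, i.e. $\mathfrak m_T^2$ is principal, and short if $\mathfrak m_T^4=0$. The fibre product over $\mathsf k$ is $A\times_{\mathsf k}B=\{(a,b)\in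 A\times B:\pi_A(a)=\pi_B(b)\}$, where $\pi_A,\pi_B$ are the natural projections onto $\mathsf k$.
   Formalization: The claim that B has Loewy length 1 fails when G is Gorenstein (e.g. Q = k[x]/(x^4), where G = Q has type 1), so the formal statement gives Loewy length 1 for B when G is not Gorenstein and 0 (B = k) when G is Gorenstein. *)

(* Defs.v *)
From HB Require Import structures.
From mathcomp Require Import all_boot all_order all_algebra all_classical.

Set Implicit Arguments.
Unset Strict Implicit.
Unset Printing Implicit Defensive.

Import GRing.Theory.
Local Open Scope ring_scope.
Local Open Scope classical_set_scope.
Local Open Scope quotient_scope.

Section Ideals.
Variable R : comNzRingType.
Implicit Types I J M : set R.

Definition is_ideal I :=
  [/\ I 0, (forall x y, I x -> I y -> I (x + y)) & forall a x, I x -> I (a * x)].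

Definition ideal_mul I J : set R :=
  [set x | exists n (a b : 'I_n -> R),
     [/\ forall i, I (a i), forall i, J (b i) & x = \sum_i a i * b i]].

Fixpoint ideal_pow I n : set R :=
  if n is n'.+1 then ideal_mul I (ideal_pow I n') else setT.

Definition ideal_gen n (g : 'I_n -> R) : set R :=
  [set x | exists a : 'I_n -> R, x = \sum_i a i * g i].

Definition ann I : set R := [set x | forall y, I y -> x * y = 0].

Definition is_maximal_ideal M :=
  [/\ is_ideal M, ~ M 1 &
      forall I, is_ideal I -> ~ I 1 -> M `<=` I -> I = M].

Definition artinian :=
  forall I : nat -> set R,
    (forall n, is_ideal (I n)) -> (forall n, I n.+1 `<=` I n) ->
    exists n, forall j, (n <= j)%N -> I j = I n.

End Ideals.

(* Numerical invariants of a ring R with residue map rho onto k; they are used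
   both for local rings and for graded algebras, whose (homogeneous) maximal
   ideal is the kernel of rho. *)
Section Invariants.
Variables (k : fieldType) (R : comNzRingType) (rho : R -> k).

Definition maxideal : set R := [set x | rho x = 0].

Local Notation m := maxideal.

(* n is the k-dimension of I / J, for ideals J of I with m I contained in J.
   The scalar rho a acts on I / J as multiplication by a, so the classes of the
   e i form a k-basis iff they generate I modulo J and any relation between
   them has all its coefficients in m. *)
Definition is_subquo_dim (I J : set R) (n : nat) :=
  exists e : 'I_n -> R,
    [/\ forall i, I (e i),
        forall x, I x -> exists a : 'I_n -> R, J (x - \sum_i a i * e i)
      & forall a : 'I_n -> R, J (\sum_i a i * e i) -> forall i, rho (a i) = 0].

Definition subquo_dim I J : nat := xget 0%N [set n | is_subquo_dim I J n].

Definition hilb (i : nat) : nat :=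
  subquo_dim (ideal_pow m i) (ideal_pow m i.+1).

Definition edim : nat :=
  xget 0%N [set n | (exists g : 'I_n -> R, m = ideal_gen g) /\
    forall j, (exists g : 'I_j -> R, m = ideal_gen g) -> (n <= j)%N].

Definition soc : set R := ann m.

Definition cmtype : nat := subquo_dim soc [set 0].

Definition loewy : nat :=
  xget 0%N [set n | ideal_pow m n <> [set 0] /\
    forall j, ideal_pow m j <> [set 0] -> (j <= n)%N].

(* An Artinian local ring is Gorenstein iff it has type 1. *)
Definition gorenstein := artinian R /\ cmtype = 1%N.

Definition short := ideal_pow m 4 = [set 0].

Definition stretched :=
  exists h : nat, forall i, (i <= loewy)%N -> hilb i = if i == 1%N then h else 1%N.

End Invariants.

(* A local ring (R, m, k), the residue field being given by a surjection onto k
   whose kernel is the unique maximal ideal. *)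
Record localRing (k : fieldType) := LocalRing {
  lring :> comNzRingType;
  res : {rmorphism lring -> k};
  res_surj : forall c, exists x, res x = c;
  local_max : forall M : set lring, is_maximal_ideal M -> M = maxideal res
}.

(* Commutative N-graded k-algebras with degree zero part k. *)
Record gradedAlg (k : fieldType) := GradedAlg {
  galg :> comAlgType k;
  gcomp : nat -> set galg;
  gcomp_0 : forall i, gcomp i 0;
  gcompD : forall i x y, gcomp i x -> gcomp i y -> gcomp i (x + y);
  gcompZ : forall i c x, gcomp i x -> gcomp i (c *: x);
  gcompM : forall i j x y, gcomp i x -> gcomp j y -> gcomp (i + j) (x * y);
  gcomp_deg0 : gcomp 0 = [set c%:A | c in [set: k]];
  gdecomp : forall x, exists n (f : nat -> galg),
    (forall i, gcomp i (f i)) /\ x = \sum_(i < n) f i;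
  gindep : forall n (f : nat -> galg), (forall i, gcomp i (f i)) ->
    \sum_(i < n) f i = 0 -> forall i, (i < n)%N -> f i = 0
}.

Section Augmentation.
Variables (k : fieldType) (A : gradedAlg k).

Definition irrelevant : set A :=
  [set x | exists n (f : nat -> A),
     (forall i, gcomp i.+1 (f i)) /\ x = \sum_(i < n) f i].

(* The projection of A onto k = A_0. *)
Definition aug (x : A) : k := xget 0 [set c | irrelevant (x - c%:A)].

Lemma irrelevant0 : irrelevant 0.
Proof.
by exists 0%N, (fun=> 0); split; [move=> i; apply: gcomp_0 | rewrite big_ord0].
Qed.

Lemma zero_pad (P : nat -> set A) n N (f : nat -> A) : (n <= N)%N ->
  (forall i, P i 0) -> (forall i, P i (f i)) ->
  exists g : nat -> A, (forall i, P i (g i)) /\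
    \sum_(i < n) f i = \sum_(i < N) g i.
Proof.
move=> nN P0 Pf; exists (fun i => if (i < n)%N then f i else 0); split.
  by move=> i; case: ifP.
by rewrite (big_ord_widen _ _ nN) big_mkcond.
Qed.

Lemma irrelevantD x y : irrelevant x -> irrelevant y -> irrelevant (x + y).
Proof.
move=> [n [f [fP ->]]] [p [g [gP ->]]].
have P0 i : @gcomp _ A i.+1 0 by apply: gcomp_0.
have [f' [f'P ->]] := zero_pad (P := fun i => @gcomp _ A i.+1) (leq_maxl n p) P0 fP.
have [g' [g'P ->]] := zero_pad (P := fun i => @gcomp _ A i.+1) (leq_maxr n p) P0 gP.
exists (maxn n p), (fun i => f' i + g' i); split; last by rewrite big_split.
by move=> i; apply: gcompD.
Qed.

Lemma irrelevantZ c x : irrelevant x -> irrelevant (c *: x).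
Proof.
move=> [n [f [fP ->]]]; exists n, (fun i => c *: f i); split.
  by move=> i; apply: gcompZ.
by rewrite scaler_sumr.
Qed.

Lemma irrelevant_comp i x : gcomp i.+1 x -> irrelevant x.
Proof.
move=> xP; exists i.+1, (fun j => if j == i then x else 0); split.
  by move=> j; case: eqP => [->//|_]; apply: gcomp_0.
rewrite -(big_mkord xpredT (fun j => if j == i then x else 0)) big_nat_recr //=.
rewrite eqxx big_nat big1 ?add0r // => j /andP[_ ji].
by rewrite ltn_eqF.
Qed.

Lemma irrelevant_sum n (F : 'I_n -> A) :
  (forall i, irrelevant (F i)) -> irrelevant (\sum_i F i).
Proof.
by move=> FP; apply: (big_ind irrelevant) => //; [exact: irrelevant0 | exact: irrelevantD].
Qed.

Lemma irrelevantMl a x : irrelevant x -> irrelevant (a * x).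
Proof.
move=> [n [f [fP ->]]]; have [p [g [gP ->]]] := gdecomp a.
rewrite mulr_suml; apply: irrelevant_sum => i.
rewrite mulr_sumr; apply: irrelevant_sum => j.
by apply: (@irrelevant_comp (i + j)%N); rewrite -addnS; apply: gcompM.
Qed.

Lemma irrelevant_alg c : irrelevant c%:A -> c = 0.
Proof.
move=> [n [f [fP e]]].
pose g i := if i is i'.+1 then f i' else - (c%:A : A).
have gP i : gcomp i (g i).
  by case: i => [|i] //=; rewrite gcomp_deg0; exists (- c); rewrite //= scaleNr.
have := gindep (n := n.+1) gP; rewrite big_ord_recl /= -e addNr.
move=> /(_ erefl 0%N isT) /= /eqP; rewrite oppr_eq0 scaler_eq0 oner_eq0 orbF.
by move/eqP.
Qed.

Lemma irrelevantN x : irrelevant x -> irrelevant (- x).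
Proof. by move=> /(irrelevantZ (-1)); rewrite scaleN1r. Qed.

Lemma augP x : irrelevant (x - (aug x)%:A).
Proof.
rewrite /aug; case: xgetP => [c _ //|] noc; exfalso.
have [n [f [fP xE]]] := gdecomp x.
have := fP 0%N; rewrite gcomp_deg0 => -[c _ f0].
case: n xE => [|n] xE.
  by apply: (noc 0); rewrite /= xE big_ord0 scale0r subrr; exact: irrelevant0.
apply: (noc c); rewrite /= xE big_ord_recl -f0 addrAC subrr add0r.
by exists n, (fun i => f i.+1); split.
Qed.

Lemma aug_unique x c : irrelevant (x - c%:A) -> aug x = c.
Proof.
move=> h; apply/eqP; rewrite -subr_eq0; apply/eqP/irrelevant_alg.
have := irrelevantD h (irrelevantN (augP x)).
by rewrite opprB addrC addrA subrK scalerBl.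
Qed.

Fact aug_zmod_morphism : zmod_morphism aug.
Proof.
move=> x y; apply: aug_unique.
have := irrelevantD (augP x) (irrelevantN (augP y)).
by rewrite scalerBl !opprD !opprK addrACA.
Qed.
HB.instance Definition _ := GRing.isZmodMorphism.Build A k aug aug_zmod_morphism.

Fact aug_monoid_morphism : monoid_morphism aug.
Proof.
split.
  by apply: aug_unique; rewrite scale1r subrr; exact: irrelevant0.
move=> x y; apply: aug_unique.
have -> : x * y - (aug x * aug y)%:A =
    x * (y - (aug y)%:A) + (aug y)%:A * (x - (aug x)%:A).
  have -> : (aug x * aug y)%:A = (aug y)%:A * (aug x)%:A :> A.
    by rewrite -scalerAl mul1r scalerA mulrC.
  by rewrite !mulrBr [(aug y)%:A * x]mulrC addrA subrK.
by apply: irrelevantD; apply: irrelevantMl; exact: augP.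
Qed.
HB.instance Definition _ :=
  GRing.isMonoidMorphism.Build A k aug aug_monoid_morphism.

Lemma aug_alg c : aug c%:A = c.
Proof. by apply: aug_unique; rewrite subrr; exact: irrelevant0. Qed.

Lemma aug_scale c x : aug (c *: x) = c * aug x.
Proof. by rewrite -[c *: x]mulr_algl rmorphM /= aug_alg. Qed.

Lemma aug_comp i x : gcomp i.+1 x -> aug x = 0.
Proof.
by move=> /irrelevant_comp h; apply: aug_unique; rewrite scale0r subr0.
Qed.

Lemma maxideal_aug : maxideal aug = irrelevant.
Proof.
apply/seteqP; split => x /=.
  by move=> h; have := augP x; rewrite h scale0r subr0.
by move=> h; apply: aug_unique; rewrite scale0r subr0.
Qed.

End Augmentation.

Definition graded_iso (k : fieldType) (A B : gradedAlg k) :=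
  exists f : {lrmorphism A -> B},
    bijective f /\ forall i x, gcomp i x <-> gcomp i (f x).

(* The fibre product of A and B over k, as a graded subalgebra of A * B. *)
Section FibreProduct.
Variables (k : fieldType) (A B : gradedAlg k).

Definition fibre_pred : {pred (A * B)%type} := fun x => aug x.1 == aug x.2.

Fact fibre_subalg_closed : GRing.subalg_closed fibre_pred.
Proof.
split.
- by apply/eqP; rewrite /= !rmorph1.
- move=> c x y /eqP hx /eqP hy; apply/eqP => /=.
  by rewrite !rmorphD /= !aug_scale hx hy.
- by move=> x y /eqP hx /eqP hy; apply/eqP => /=; rewrite !rmorphM /= hx hy.
Qed.
HB.instance Definition _ :=
  GRing.isSubalgClosed.Build k (A * B)%type fibre_pred fibre_subalg_closed.

Record fibre := Fibre { fibre_val : (A * B)%type; _ : fibre_val \in fibre_pred }.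
HB.instance Definition _ := [isSub for fibre_val].
HB.instance Definition _ := [Choice of fibre by <:].
HB.instance Definition _ := [SubChoice_isSubComNzRing of fibre by <:].
HB.instance Definition _ := [SubZmodule_isSubLmodule of fibre by <:].
HB.instance Definition _ := [SubNzRing_SubLmodule_isSubLalgebra of fibre by <:].
HB.instance Definition _ := [SubLalgebra_isSubAlgebra of fibre by <:].

Definition fibre_comp (i : nat) : set fibre :=
  [set x | gcomp i (\val x).1 /\ gcomp i (\val x).2].

Fact fibre_comp_deg0 : fibre_comp 0 = [set c%:A | c in [set: k]].
Proof.
apply/seteqP; split => x /=.
  move=> []; rewrite !gcomp_deg0 => -[a _ aE] [b _ bE].
  have := valP x; rewrite /= -topredE /= /fibre_pred -aE -bE !aug_alg => /eqP ab.
  exists a => //; apply: val_inj; rewrite linearZ /= [RHS]surjective_pairing.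
  by rewrite -[in RHS]aE -[in RHS]bE -ab.
move=> [c _ <-].
have e : \val (c%:A : fibre) = (c%:A, c%:A) by rewrite linearZ.
by split; rewrite e gcomp_deg0; exists c.
Qed.

Fact fibre_decomp (x : fibre) : exists n (f : nat -> fibre),
  (forall i, fibre_comp i (f i)) /\ x = \sum_(i < n) f i.
Proof.
have [n [f [fP fE]]] := gdecomp (\val x).1.
have [p [g [gP gE]]] := gdecomp (\val x).2.
have [f' [f'P f'E]] := zero_pad (P := @gcomp _ A)
  (leqW (leq_maxl n p)) (gcomp_0 A) fP.
have [g' [g'P g'E]] := zero_pad (P := @gcomp _ B)
  (leqW (leq_maxr n p)) (gcomp_0 B) gP.
have aug0 (C : gradedAlg k) (h : nat -> C) N : (forall i, gcomp i (h i)) ->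
    aug (\sum_(i < N.+1) h i) = aug (h 0%N).
  move=> hP; rewrite big_ord_recl rmorphD rmorph_sum /= big1 ?addr0 // => i _.
  exact: aug_comp (hP _).
have fib i : (f' i, g' i) \in fibre_pred.
  case: i => [|i]; last by rewrite -topredE /= /fibre_pred /= !(aug_comp (i := i)).
  rewrite -topredE /= /fibre_pred /= -(aug0 _ f' (maxn n p) f'P).
  rewrite -(aug0 _ g' (maxn n p) g'P) -f'E -g'E -fE -gE.
  exact: (valP x).
exists (maxn n p).+1, (fun i => Fibre (fib i)); split.
  by move=> i; split; [exact: f'P | exact: g'P].
apply: val_inj; rewrite rmorph_sum /= [LHS]surjective_pairing fE gE f'E g'E.
by rewrite [RHS]surjective_pairing !raddf_sum.
Qed.

Fact fibre_indep n (f : nat -> fibre) : (forall i, fibre_comp i (f i)) ->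
  \sum_(i < n) f i = 0 -> forall i, (i < n)%N -> f i = 0.
Proof.
move=> fP f0 i ltin.
have sum0 : \sum_(i < n) \val (f i) = 0 by rewrite -rmorph_sum f0 rmorph0.
apply: val_inj; rewrite rmorph0 [LHS]surjective_pairing.
congr (_, _).
  apply: (gindep (f := fun i => (\val (f i)).1)) ltin => [j|].
    by have [] := fP j.
  by rewrite -[RHS]/((0 : A * B).1) -sum0 raddf_sum.
apply: (gindep (f := fun i => (\val (f i)).2)) ltin => [j|].
  by have [] := fP j.
by rewrite -[RHS]/((0 : A * B).2) -sum0 raddf_sum.
Qed.

Fact fibre_comp_0 i : fibre_comp i 0.
Proof. by split; rewrite rmorph0; apply: gcomp_0. Qed.

Fact fibre_compD i x y :
  fibre_comp i x -> fibre_comp i y -> fibre_comp i (x + y).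
Proof. by move=> [? ?] [? ?]; split; rewrite rmorphD; apply: gcompD. Qed.

Fact fibre_compZ i c x : fibre_comp i x -> fibre_comp i (c *: x).
Proof. by move=> [? ?]; split; rewrite linearZ; apply: gcompZ. Qed.

Fact fibre_compM i j x y :
  fibre_comp i x -> fibre_comp j y -> fibre_comp (i + j) (x * y).
Proof. by move=> [? ?] [? ?]; split; rewrite rmorphM; apply: gcompM. Qed.

Definition fibre_product : gradedAlg k :=
  GradedAlg fibre_comp_0 fibre_compD fibre_compZ fibre_compM
    fibre_comp_deg0 fibre_decomp fibre_indep.

End FibreProduct.

Section IdealTheory.
Variable R : comNzRingType.
Implicit Types I J : set R.

Lemma ideal_sum I n (F : 'I_n -> R) :
  is_ideal I -> (forall i, I (F i)) -> I (\sum_i F i).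
Proof. by move=> [I0 ID _] FI; apply: (big_ind I). Qed.

Lemma ideal_mulM I J x y : I x -> J y -> ideal_mul I J (x * y).
Proof.
move=> Ix Jy; exists 1%N, (fun=> x), (fun=> y); split=> //.
by rewrite big_ord1.
Qed.

Lemma ideal_mul_ideal I J : is_ideal I -> is_ideal (ideal_mul I J).
Proof.
move=> [I0 ID IM]; split.
- by exists 0%N, (fun=> 0), (fun=> 0); split; [case | case | rewrite big_ord0].
- move=> x y [n [a [b [aI bJ ->]]]] [p [c [d [cI dJ ->]]]].
  exists (n + p)%N,
    (fun i => match fintype.split i with inl j => a j | inr j => c j end),
    (fun i => match fintype.split i with inl j => b j | inr j => d j end).
  split; [by move=> i; case: fintype.split | by move=> i; case: fintype.split |].
  rewrite big_split_ord /=; congr (_ + _); apply: eq_bigr => i _.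
    by rewrite (unsplitK (inl i)).
  by rewrite (unsplitK (inr i)).
- move=> z x [n [a [b [aI bJ ->]]]].
  exists n, (fun i => z * a i), b; split=> //; first by move=> i; apply: IM.
  by rewrite mulr_sumr; apply: eq_bigr => i _; rewrite mulrA.
Qed.

Lemma ideal_pow_ideal I n : is_ideal I -> is_ideal (ideal_pow I n).
Proof. by move=> II; case: n => [//|n]; apply: ideal_mul_ideal. Qed.

Lemma ideal_powD I i j x y : is_ideal I ->
  ideal_pow I i x -> ideal_pow I j y -> ideal_pow I (i + j) (x * y).
Proof.
move=> II; elim: i x => [|i IH] x /=.
  by move=> _ yj; have [_ _] := ideal_pow_ideal j II; apply.
move=> [n [a [b [aI bI ->]]]] yj; rewrite mulr_suml.
apply: (ideal_sum (ideal_pow_ideal (i + j).+1 II)) => l.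
by rewrite -mulrA; apply: ideal_mulM => //; apply: IH.
Qed.

Lemma ideal_powS I i x : is_ideal I -> ideal_pow I i.+1 x -> ideal_pow I i x.
Proof.
move=> II [n [a [b [aI bI ->]]]].
have [I0 ID IM] := ideal_pow_ideal i II.
by apply: (big_ind (ideal_pow I i)) => // l _; apply: IM; exact: bI.
Qed.

End IdealTheory.

(* gr(Q) is built as a quotient of the Rees ring: a polynomial with i-th
   coefficient in m^i stands for the family of the classes of its coefficients
   in the direct sum of the m^i / m^(i+1). *)
Section AssociatedGraded.
Variables (k : fieldType) (Q : localRing k).

Local Notation m := (maxideal (res Q)).

Lemma maxideal_ideal : is_ideal m.
Proof.
split=> [|x y|a x]; rewrite /maxideal /= ?rmorph0 // ?rmorphD ?rmorphM.
  by move=> -> ->; rewrite addr0.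
by move=> ->; rewrite mulr0.
Qed.

Let powI i := ideal_pow_ideal i maxideal_ideal.

Lemma pow0 i : ideal_pow m i 0. Proof. by have [] := powI i. Qed.

Lemma pow1N : ~ ideal_pow m 1 1.
Proof.
move=> [n [a [b [am _ /(congr1 (res Q))]]]].
rewrite rmorph1 rmorph_sum big1 => [/eqP|i _]; first by rewrite oner_eq0.
by rewrite rmorphM [res Q (a i)]am mul0r.
Qed.

Lemma pow1 x : m x -> ideal_pow m 1 x.
Proof. by move=> mx; rewrite -[x]mulr1; apply: ideal_mulM. Qed.

Definition rees_pred : {pred {poly Q}} :=
  fun p => `[< forall i, ideal_pow m i p`_i >].

Fact rees_closed : GRing.subring_closed rees_pred.
Proof.
split.
- apply/asboolP => i; rewrite coef1; case: i => [|i] //=.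
  exact: (pow0 i.+1).
- move=> p q /asboolP hp /asboolP hq; apply/asboolP => i.
  have [_ D M] := powI i; rewrite coefB -mulN1r.
  by apply: D; [exact: hp | apply: M; exact: hq].
- move=> p q /asboolP hp /asboolP hq; apply/asboolP => i.
  rewrite coefM; apply: (ideal_sum (powI i)) => j.
  by rewrite -{1}(subnKC (leq_ord j)); apply: (ideal_powD maxideal_ideal).
Qed.
HB.instance Definition _ :=
  GRing.isSubringClosed.Build {poly Q} rees_pred rees_closed.

Record rees := Rees { rees_val : {poly Q}; _ : rees_val \in rees_pred }.
HB.instance Definition _ := [isSub for rees_val].
HB.instance Definition _ := [Choice of rees by <:].
HB.instance Definition _ := [SubChoice_isSubComNzRing of rees by <:].

Lemma rees_val0 : rees_val 0 = 0. Proof. exact: (rmorph0 (val : rees -> _)). Qed.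
Lemma rees_val1 : rees_val 1 = 1. Proof. exact: (rmorph1 (val : rees -> _)). Qed.
Lemma rees_valB p q : rees_val (p - q) = rees_val p - rees_val q.
Proof. exact: (rmorphB (val : rees -> _)). Qed.
Lemma rees_valD p q : rees_val (p + q) = rees_val p + rees_val q.
Proof. exact: (rmorphD (val : rees -> _)). Qed.
Lemma rees_valM p q : rees_val (p * q) = rees_val p * rees_val q.
Proof. exact: (rmorphM (val : rees -> _)). Qed.
Lemma rees_val_sum n (F : 'I_n -> rees) :
  rees_val (\sum_i F i) = \sum_i rees_val (F i).
Proof. exact: (rmorph_sum (val : rees -> _)). Qed.
Definition rees_valE :=
  (rees_val0, rees_val1, rees_valB, rees_valD, rees_valM, rees_val_sum).

Lemma reesP (p : rees) i : ideal_pow m i (rees_val p)`_i.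
Proof. by have /asboolP := valP p. Qed.

Definition gr_pred : {pred rees} :=
  fun p => `[< forall i, ideal_pow m i.+1 (rees_val p)`_i >].

Fact gr_closed : idealr_closed gr_pred.
Proof.
split.
- by apply/asboolP => i; rewrite rees_valE coef0; exact: (pow0 i.+1).
- apply/asboolP => /(_ 0%N); rewrite rees_valE coef1; exact: pow1N.
- move=> a p q /asboolP hp /asboolP hq; apply/asboolP => i.
  have [_ D _] := powI i.+1.
  rewrite !rees_valE coefD coefM; apply: D; last exact: hq.
  apply: (ideal_sum (powI i.+1)) => j.
  rewrite -{1}(subnKC (leq_ord j)) -addnS.
  by apply: (ideal_powD maxideal_ideal); [exact: reesP | exact: hp].
Qed.
HB.instance Definition _ := isIdealr.Build rees gr_pred gr_closed.

Definition gr_type := {ideal_quot gr_pred}.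
HB.instance Definition _ := GRing.ComNzRing.on gr_type.

Definition gr_pi (p : rees) : gr_type := \pi_{ideal_quot gr_pred} p.

Fact gr_pi_zmod_morphism : zmod_morphism gr_pi.
Proof. exact: raddfB. Qed.
HB.instance Definition _ :=
  GRing.isZmodMorphism.Build rees gr_type gr_pi gr_pi_zmod_morphism.
Fact gr_pi_monoid_morphism : monoid_morphism gr_pi.
Proof. by split; [exact: rmorph1 | exact: rmorphM]. Qed.
HB.instance Definition _ :=
  GRing.isMonoidMorphism.Build rees gr_type gr_pi gr_pi_monoid_morphism.

Lemma gr_pi_surj (x : gr_type) : exists p, x = gr_pi p.
Proof. by exists (repr x); rewrite /gr_pi reprK. Qed.

Lemma gr_pi0 p : gr_pi p = 0 <-> forall i, ideal_pow m i.+1 (rees_val p)`_i.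
Proof.
rewrite -(rmorph0 gr_pi); split.
  move=> /eqP; rewrite -Quotient.idealrBE subr0 => /asboolP; exact.
by move=> h; apply/eqP; rewrite -Quotient.idealrBE subr0; apply/asboolP.
Qed.

Fact rees_mon_subproof i (x : Q) :
  ((if `[< ideal_pow m i x >] then x else 0) *: 'X^i) \in rees_pred.
Proof.
apply/asboolP => j; rewrite coefZ coefXn; case: eqP => [->|_].
  by rewrite mulr1; case: asboolP => // _; exact: pow0.
by rewrite mulr0; exact: pow0.
Qed.

(* x t^i if x is in m^i, and 0 otherwise *)
Definition rees_mon i x := Rees (rees_mon_subproof i x).

Lemma rees_monE i x : ideal_pow m i x -> rees_val (rees_mon i x) = x *: 'X^i.
Proof. by move=> h /=; rewrite asboolT. Qed.

Definition gr_comp i : set gr_type :=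
  [set gr_pi (rees_mon i x) | x in ideal_pow m i].

(* The scalar c acts as any of its lifts to Q. *)
Definition klift (c : k) : Q := xget 0 [set x | res Q x = c].

Lemma kliftK c : res Q (klift c) = c.
Proof. by rewrite /klift; apply: (@xgetPex _ 0 [set x | res Q x = c]); exact: res_surj. Qed.

Definition gr_cst (x : Q) : gr_type := gr_pi (rees_mon 0 x).

Lemma gr_cst_eq x y : res Q x = res Q y -> gr_cst x = gr_cst y.
Proof.
move=> h; apply/eqP; rewrite -subr_eq0 -rmorphB; apply/eqP/gr_pi0 => i.
rewrite rees_valE !rees_monE // -scalerBl coefZ coefXn.
case: i => [|i]; last by rewrite mulr0; exact: (pow0 i.+2).
by rewrite mulr1; apply: pow1; rewrite /maxideal /= rmorphB h subrr.
Qed.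

Lemma gr_cst1 : gr_cst 1 = 1.
Proof.
rewrite -(rmorph1 gr_pi); congr gr_pi; apply: (val_inj : injective rees_val).
by rewrite rees_monE // rees_valE scale1r expr0.
Qed.

Lemma gr_cstD x y : gr_cst (x + y) = gr_cst x + gr_cst y.
Proof.
rewrite -rmorphD; congr gr_pi; apply: (val_inj : injective rees_val).
by rewrite rees_valE !rees_monE // scalerDl.
Qed.

Lemma gr_cstM x y : gr_cst (x * y) = gr_cst x * gr_cst y.
Proof.
rewrite -rmorphM; congr gr_pi; apply: (val_inj : injective rees_val).
by rewrite rees_valE !rees_monE // !expr0 -scalerAl mul1r scalerA.
Qed.

Definition gr_scale (c : k) (x : gr_type) : gr_type := gr_cst (klift c) * x.

Fact gr_scaleA a b v : gr_scale a (gr_scale b v) = gr_scale (a * b) v.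
Proof.
rewrite /gr_scale mulrA -gr_cstM; congr (_ * _); apply: gr_cst_eq.
by rewrite rmorphM !kliftK.
Qed.
Fact gr_scale1 : left_id 1 gr_scale.
Proof.
move=> v; rewrite /gr_scale (@gr_cst_eq _ 1) ?gr_cst1 ?mul1r //.
by rewrite kliftK rmorph1.
Qed.
Fact gr_scaleDr : right_distributive gr_scale +%R.
Proof. by move=> c u v; rewrite /gr_scale mulrDr. Qed.
Fact gr_scaleDl v : {morph gr_scale^~ v : a b / a + b}.
Proof.
move=> a b; rewrite /gr_scale -mulrDl -gr_cstD; congr (_ * _).
by apply: gr_cst_eq; rewrite rmorphD !kliftK.
Qed.
HB.instance Definition _ := GRing.Zmodule_isLmodule.Build k gr_type
  gr_scaleA gr_scale1 gr_scaleDr gr_scaleDl.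
Fact gr_scaleAl (a : k) (u v : gr_type) : a *: (u * v) = (a *: u) * v.
Proof. exact: mulrA. Qed.
HB.instance Definition _ := GRing.Lmodule_isLalgebra.Build k gr_type gr_scaleAl.
HB.instance Definition _ := GRing.Lalgebra_isComAlgebra.Build k gr_type.

Lemma gr_scale_cst (x : Q) (v : gr_type) : gr_cst x * v = res Q x *: v.
Proof. by congr (_ * _); apply: gr_cst_eq; rewrite kliftK. Qed.

Fact gr_comp_0 i : gr_comp i 0.
Proof.
exists 0; first exact: pow0.
by rewrite -(rmorph0 gr_pi); congr gr_pi; apply: (val_inj : injective rees_val);
  rewrite rees_monE ?scale0r ?rees_valE //; exact: pow0.
Qed.

Fact gr_compD i x y : gr_comp i x -> gr_comp i y -> gr_comp i (x + y).
Proof.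
move=> [a am <-] [b bm <-]; have [_ D _] := powI i.
exists (a + b); first exact: D.
rewrite -rmorphD; congr gr_pi; apply: (val_inj : injective rees_val).
by rewrite rees_valE !rees_monE ?scalerDl //; exact: D.
Qed.

Fact gr_compM i j x y : gr_comp i x -> gr_comp j y -> gr_comp (i + j) (x * y).
Proof.
move=> [a am <-] [b bm <-].
have abm := ideal_powD maxideal_ideal am bm.
exists (a * b) => //; rewrite -rmorphM; congr gr_pi; apply: (val_inj : injective rees_val).
rewrite rees_valE !rees_monE //.
by rewrite -scalerAl -scalerAr scalerA exprD.
Qed.

Fact gr_compZ i c x : gr_comp i x -> gr_comp i (c *: x).
Proof. by apply: (@gr_compM 0 i); exists (klift c). Qed.

Fact gr_comp_deg0 : gr_comp 0 = [set c%:A | c in [set: k]].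
Proof.
apply/seteqP; split => x /=.
  move=> [a _ <-]; exists (res Q a) => //.
  by rewrite -gr_scale_cst mulr1.
by move=> [c _ <-]; exists (klift c) => //; rewrite -[LHS]mulr1.
Qed.

Fact gr_decomp (x : gr_type) : exists n (f : nat -> gr_type),
  (forall i, gr_comp i (f i)) /\ x = \sum_(i < n) f i.
Proof.
have [p ->] := gr_pi_surj x.
exists (size (rees_val p)), (fun i => gr_pi (rees_mon i (rees_val p)`_i)); split.
  by move=> i; exists (rees_val p)`_i => //; exact: reesP.
rewrite -rmorph_sum; congr gr_pi; apply: (val_inj : injective rees_val).
rewrite rees_valE -[LHS]coefK poly_def; apply: eq_bigr => i _.
by rewrite rees_monE //; exact: reesP.
Qed.

Fact gr_indep n (f : nat -> gr_type) : (forall i, gr_comp i (f i)) ->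
  \sum_(i < n) f i = 0 -> forall i, (i < n)%N -> f i = 0.
Proof.
move=> fP f0 i ltin.
have /choice[a aP] : forall j, exists b, ideal_pow m j b /\
    gr_pi (rees_mon j b) = f j.
  by move=> j; have [b bm <-] := fP j; exists b.
have : gr_pi (\sum_(j < n) rees_mon j (a j)) = 0.
  by rewrite rmorph_sum -[RHS]f0; apply: eq_bigr => j _; have [] := aP j.
move=> /gr_pi0/(_ i); rewrite rees_valE coef_sum.
rewrite (bigD1 (Ordinal ltin)) // big1 => [|j ji].
  have [am <-] := aP i; rewrite rees_monE // [X in ideal_pow _ _ X]addr0 => h.
  apply/gr_pi0 => j; move: h; rewrite rees_monE // !coefZ !coefXn eqxx mulr1.
  case: eqP => [->|_] h; first by rewrite mulr1.
  by rewrite mulr0; exact: (pow0 j.+1).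
have [am _] := aP j; rewrite rees_monE // coefZ coefXn.
by rewrite eq_sym [_ == i](negPf ji) mulr0.
Qed.

Definition gr : gradedAlg k :=
  GradedAlg gr_comp_0 gr_compD gr_compZ gr_compM gr_comp_deg0 gr_decomp gr_indep.

End AssociatedGraded.

Arguments aug {k} A x.

(* Main.v *)
(* Let m be the maximal ideal of Q. Since Q is Gorenstein, soc(Q) = m^s is a line.
   In the short and in the stretched case, an x in m^i with 2 <= i < s and
   x m contained in m^(i+2) lies in m^(i+1), so the socle of G = gr(Q) lives in
   degrees 1 and s only. Hence the multiplication G_1 x G_(s-1) -> G_s = k has
   trivial right kernel and its left kernel is N = soc(G) in degree 1; counting
   dimensions gives dim N = edim(Q) - H_Q(s-1). A complement of N in G_1
   determines a projection of G onto N, whose kernel A is a Gorenstein subalgebra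
   of socle degree s, and B = k + N is the other factor. *)
Require Import Defs.
From HB Require Import structures.
From mathcomp Require Import all_boot all_order all_algebra all_classical zify.

Set Implicit Arguments.
Unset Strict Implicit.
Unset Printing Implicit Defensive.

Import GRing.Theory.
Local Open Scope ring_scope.
Local Open Scope classical_set_scope.

(** * Ideals and dimensions of subquotients *)

Section Ideals.
Variable R : comNzRingType.
Implicit Types I J : set R.

(** The short or stretched hypothesis serves only to clear the socle of G from degrees 2 to s-1;
    afterwards both cases share one argument about a standard graded algebra whose top degree is a
    line. The condition s >= 3 places degree s-1 itself in that range, and this is why the pairing
    has no right kernel. On the left, an element of G_1 that kills G_(s-1) also kills the lower
    positive degrees, one after another, because each product falls in a degree without socle. The
    projection onto N factors through the degree one component, so it is a derivation over the
    augmentation. As N is killed by m_G, subtracting this projection, or adding it to the constant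
    term, gives ring morphisms; these are the two coordinates of the fibre product. N may vanish:
    then G is Gorenstein and B = k has Loewy length 0. Dimensions are defined by a choice with
    default 0, so each one needs an actual finite basis; for m^i/m^(i+1) this is extracted directly
    from the descending chain condition. *)

Lemma idealN I x : is_ideal I -> I x -> I (- x).
Proof. by move=> [_ _ IM] Ix; rewrite -mulN1r; apply: IM. Qed.

Lemma idealB I x y : is_ideal I -> I x -> I y -> I (x - y).
Proof. by move=> II Ix Iy; have [_ ID _] := II; apply: ID => //; apply: idealN. Qed.

Lemma ideal_pow_le I i j : is_ideal I -> (i <= j)%N ->
  ideal_pow I j `<=` ideal_pow I i.
Proof.
move=> II /subnK <-; elim: (j - i)%N => [//|d IH] x.
by rewrite addSn => /(ideal_powS II) /IH.
Qed.

Lemma ideal_pow1 I : is_ideal I -> ideal_pow I 1 = I.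
Proof.
move=> II; have [_ _ IM] := II; apply/seteqP; split=> x /=.
  move=> [n [a [b [aI _ ->]]]]; apply: (ideal_sum II) => i.
  by rewrite mulrC; apply: IM.
by move=> Ix; rewrite -[x]mulr1; apply: ideal_mulM.
Qed.

Lemma ideal_pow0 I n p : is_ideal I -> ideal_pow I n = [set 0] -> (n <= p)%N ->
  ideal_pow I p = [set 0].
Proof.
move=> II In0 np; apply/seteqP; split=> x /=; last first.
  by move=> ->; have [] := ideal_pow_ideal p II.
by move=> /(ideal_pow_le II np); rewrite In0.
Qed.

End Ideals.

Lemma ideal_pow_morph (R S : comNzRingType) (f : {rmorphism R -> S})
    (I : set R) (J : set S) n x :
  (forall y, I y -> J (f y)) -> ideal_pow I n x -> ideal_pow J n (f x).
Proof.
move=> fIJ; elim: n x => [//|n IH] x /= [p [a [b [aI bI ->]]]].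
exists p, (f \o a), (f \o b); split=> [i|i|]; [exact: fIJ | exact: IH |].
by rewrite rmorph_sum; apply: eq_bigr => i _; rewrite rmorphM.
Qed.

Lemma artinian_surj (R S : comNzRingType) (f : {rmorphism R -> S}) :
  (forall y, exists x, f x = y) -> artinian R -> artinian S.
Proof.
move=> fsurj artR I II Idec.
have preI n : is_ideal (f @^-1` I n).
  have [I0 ID IM] := II n; split=> [|x y|a x] /=; rewrite ?rmorph0 //.
    by rewrite rmorphD; apply: ID.
  by rewrite rmorphM; apply: IM.
have [n|n stab] := artR (fun n => f @^-1` I n) preI.
  by move=> x; apply: Idec.
exists n => j nj; apply/seteqP; split=> y; have [x <-] := fsurj y => Ix.
  by have : (f @^-1` I j) x by []; rewrite stab.
by have : (f @^-1` I n) x by []; rewrite -(stab j nj).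
Qed.

Section SubquotientDimension.
Variables (k : fieldType) (R : comNzRingType) (rho : {rmorphism R -> k}).
Implicit Types I J : set R.
Local Notation m := (maxideal rho).

Lemma maxideal_rmorph : is_ideal m.
Proof.
split=> [|x y|a x]; rewrite /maxideal /= ?rmorph0 // ?rmorphD ?rmorphM.
  by move=> -> ->; rewrite addr0.
by move=> ->; rewrite mulr0.
Qed.

Lemma soc_ideal : is_ideal (soc rho).
Proof.
split=> [y|x y xs ys z mz|a x xs z mz]; first by rewrite mul0r.
  by rewrite mulrDl xs // ys // addr0.
by rewrite -mulrA xs // mulr0.
Qed.

(** Independence of [e] turns the two families of expansions into a matrix identity [MA *m MC = 1]
    over [k], which forces n <= p. No independence of [g] is involved, so the bound also applies to
    arbitrary generators of the maximal ideal. *)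
Lemma subquo_dim_le J n p (e : 'I_n -> R) (g : 'I_p -> R) : is_ideal J ->
  (forall a : 'I_n -> R, J (\sum_i a i * e i) -> forall i, rho (a i) = 0) ->
  (forall i, exists a : 'I_p -> R, J (e i - \sum_j a j * g j)) ->
  (forall j, exists a : 'I_n -> R, J (g j - \sum_i a i * e i)) ->
  (n <= p)%N.
Proof.
move=> JI efree /choice[A AP] /choice[C CP].
pose MA := \matrix_(i < n, j < p) rho (A i j).
pose MC := \matrix_(j < p, i < n) rho (C j i).
apply: (@mulmx1_min _ _ _ MA MC); apply/matrixP => i l.
have [J0 JD JM] := JI.
(* Substituting the expansions of the [g j] into that of [e i] gives a relation among the [e l]
   whose coefficients reduce to row i of [1 - MA *m MC]. *)
have : J (\sum_l ((i == l)%:R - \sum_j A i j * C j l) * e l).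
  have -> : \sum_l ((i == l)%:R - \sum_j A i j * C j l) * e l =
      (e i - \sum_j A i j * g j) + \sum_j A i j * (g j - \sum_l C j l * e l).
    transitivity (e i - \sum_j \sum_l A i j * (C j l * e l)).
      rewrite exchange_big /=; under eq_bigr do rewrite mulrBl; rewrite sumrB.
      congr (_ - _).
        rewrite (bigD1 i) //= eqxx mul1r big1 ?addr0 // => l0 l0i.
        by rewrite eq_sym (negPf l0i) mul0r.
      apply: eq_bigr => l0 _; rewrite mulr_suml; apply: eq_bigr => j _.
      by rewrite mulrA.
    under [X in _ = _ + X]eq_bigr do rewrite mulrBr.
    rewrite sumrB addrA subrK; congr (_ - _); apply: eq_bigr => j _.
    by rewrite mulr_sumr.
  by apply: JD => //; apply: ideal_sum => // j; apply: JM.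
move=> /efree/(_ l); rewrite rmorphB rmorph_sum /= rmorph_nat !mxE.
move=> /eqP; rewrite subr_eq0 => /eqP ->.
by apply: eq_bigr => j _; rewrite !mxE rmorphM.
Qed.

Lemma is_subquo_dim_unique I J n p : is_ideal J ->
  is_subquo_dim rho I J n -> is_subquo_dim rho I J p -> n = p.
Proof.
move=> JI [e [eI eP ef]] [g [gI gP gf]]; apply/eqP; rewrite eqn_leq.
apply/andP; split.
  by apply: (subquo_dim_le JI ef) => i; [apply: gP | apply: eP].
by apply: (subquo_dim_le JI gf) => i; [apply: eP | apply: gP].
Qed.

Lemma subquo_dimE I J n : is_ideal J ->
  is_subquo_dim rho I J n -> subquo_dim rho I J = n.
Proof.
move=> JI nP; rewrite /subquo_dim; case: xgetP => [p _ pP|/(_ n)//].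
exact: is_subquo_dim_unique pP nP.
Qed.

(* [subquo_dim] is a junk 0 when there is no finite basis. *)
Lemma subquo_dim_pos I J n : subquo_dim rho I J = n.+1 ->
  is_subquo_dim rho I J n.+1.
Proof. by rewrite /subquo_dim; case: xgetP => // p _ pP <-. Qed.

Lemma zero_ideal : is_ideal [set (0 : R)].
Proof.
by split=> [//|x y /= -> ->|a x /= ->]; rewrite ?addr0 ?mulr0.
Qed.

Lemma loewyE n : ideal_pow m n <> [set 0] -> ideal_pow m n.+1 = [set 0] ->
  loewy rho = n.
Proof.
move=> mn mn1; have mI := maxideal_rmorph.
have maxn j : ideal_pow m j <> [set 0] -> (j <= n)%N.
  by move=> mj; rewrite leqNgt; apply/negP => /(ideal_pow0 mI mn1).
rewrite /loewy; case: xgetP => [p _ [mp maxp]|/(_ n)[]//].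
by apply/eqP; rewrite eqn_leq maxn //= maxp.
Qed.

(** A positive value is not the default 0 of [xget], so the maximum exists. This is how nilpotency
    of the maximal ideal is obtained. *)
Lemma loewy_pos s : loewy rho = s.+1 ->
  ideal_pow m s.+1 <> [set 0] /\ ideal_pow m s.+2 = [set 0].
Proof.
rewrite /loewy; case: xgetP => // p _ [mp maxp] <-; split=> //.
by apply: contrapT => /maxp; rewrite ltnn.
Qed.

End SubquotientDimension.

(** * Finite bases of subquotients over an Artinian ring *)

Section FiniteBasis.
Variables (k : fieldType) (R : comNzRingType) (rho : {rmorphism R -> k}).
Hypothesis rho_surj : forall c, exists x, rho x = c.
Local Notation m := (maxideal rho).
Variables I J : set R.
Hypothesis JI : is_ideal J.
Hypothesis mIJ : forall a x, m a -> I x -> J (a * x).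

(** Lists grow at the head: a new vector is tested against the span of the older ones behind it,
    which matches the greedy construction of an independent family. *)
Fixpoint span_mod (s : seq R) : set R :=
  if s is e :: s' then [set x | exists a, span_mod s' (x - a * e)] else J.

Fixpoint free_mod (s : seq R) : Prop :=
  if s is e :: s' then [/\ I e, ~ span_mod s' e & free_mod s'] else True.

Lemma span_mod_ideal s : is_ideal (span_mod s).
Proof.
elim: s => [//|e s [K0 KD KM]]; split=> [|x y [a ax] [b bx]|c x [a ax]] /=.
- by exists 0; rewrite mul0r subr0.
- by exists (a + b); rewrite mulrDl opprD addrACA; apply: KD.
- by exists (c * a); rewrite -mulrA -mulrBr; apply: KM.
Qed.

Lemma span_modP s x : span_mod s x <->
  exists a : nat -> R, J (x - \sum_(i < size s) a i * s`_i).
Proof.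
elim: s x => [|e s IH] x /=.
  split=> [Jx|[a]]; last by rewrite big_ord0 subr0.
  by exists (fun=> 0); rewrite big_ord0 subr0.
split=> [[a /IH[b Jb]]|[a]].
  exists (fun i => if i is i'.+1 then b i' else a).
  by rewrite big_ord_recl opprD addrA.
rewrite big_ord_recl opprD addrA => Ja; exists (a 0%N); apply/IH.
by exists (fun i => a i.+1).
Qed.

Lemma sub_span_mod s : J `<=` span_mod s.
Proof.
move=> x Jx; elim: s => [//|e s IH] /=.
by exists 0; rewrite mul0r subr0.
Qed.

Lemma rho_unit a : rho a <> 0 -> exists b, rho (a * b) = 1.
Proof.
move=> /eqP a0; have [b bE] := rho_surj (rho a)^-1.
by exists b; rewrite rmorphM bE divff.
Qed.

(** A coefficient outside m has an inverse b modulo m only, as the ring is not assumed local here;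
    the error [(1 - a * b) * e] lies in m I and hence in J. *)
Lemma span_mod_coef s a e : I e -> ~ span_mod s e -> span_mod s (a * e) ->
  rho a = 0.
Proof.
move=> Ie se sae; apply: contrapT => /rho_unit[b ab1]; apply: se.
have [_ KD KM] := span_mod_ideal s.
have -> : e = b * (a * e) + (1 - a * b) * e.
  by rewrite mulrBl mul1r mulrA [b * a]mulrC addrC subrK.
apply: KD; first exact: KM.
by apply/sub_span_mod/mIJ => //; rewrite /maxideal /= rmorphB ab1 rmorph1 subrr.
Qed.

Lemma free_mod_coef s (a : nat -> R) : free_mod s ->
  J (\sum_(i < size s) a i * s`_i) ->
  forall i, (i < size s)%N -> rho (a i) = 0.
Proof.
have [J0 JD JM] := JI.
elim: s a => [//|e s IH] a /= [Ie se sf]; rewrite big_ord_recl => Ja.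
have a0 : rho (a 0%N) = 0.
  apply: (span_mod_coef Ie se); apply/span_modP; exists (fun i => - a i.+1).
  rewrite -sumrN; under eq_bigr do rewrite mulNr opprK.
  exact: Ja.
case=> [//|i] /=; rewrite ltnS; apply: (IH (fun i => a i.+1)) => //.
have -> : \sum_(j < size s) a j.+1 * s`_j =
    (a 0%N * e + \sum_(j < size s) a j.+1 * s`_j) - a 0%N * e.
  by rewrite addrC addKr.
by apply: idealB => //; apply: mIJ.
Qed.

Lemma free_mod_subquo_dim s : free_mod s -> I `<=` span_mod s ->
  is_subquo_dim rho I J (size s).
Proof.
move=> sf Is; exists (fun i => s`_i); split=> [i|x /Is/span_modP[a Ja]|a].
- move: sf i; elim: s {Is} => [_ []//|e s IH /= [Ie _ /IH sI]] [[|i] ilt] //=.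
  exact: (sI (Ordinal (ilt : (i < size s)%N))).
- by exists a.
- pose b i := if insub i is Some j then a j else 0.
  have bE (i : 'I_(size s)) : b i = a i by rewrite /b valK.
  under eq_bigr do rewrite -bE.
  by move=> /(free_mod_coef sf) h i; rewrite -bE; apply: h.
Qed.


Section InfiniteFamily.
Variable e : nat -> R.

Lemma sum_ord_widen (a : nat -> R) N M : (N <= M)%N ->
  (forall i, (N <= i)%N -> a i = 0) ->
  \sum_(i < M) a i * e i = \sum_(i < N) a i * e i.
Proof.
move=> NM a0; rewrite (big_ord_widen _ (fun i => a i * e i) NM) [RHS]big_mkcond.
apply: eq_bigr => i _; case: ltnP => // /a0 ->; exact: mul0r.
Qed.

(** This is J plus the ideal generated by e_n, e_(n+1), ...; the bound N only makes the support of
    the coefficients finite. *)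
Definition tail_ideal n : set R := [set x | exists N (a : nat -> R),
  [/\ forall i, (i < n)%N -> a i = 0, forall i, (N <= i)%N -> a i = 0
    & J (x - \sum_(i < N) a i * e i)]].

Lemma tail_ideal_ideal n : is_ideal (tail_ideal n).
Proof.
have [J0 JD JM] := JI; split.
- by exists 0%N, (fun=> 0); split=> //; rewrite big_ord0 subr0.
- move=> x y [N [a [an aN Ja]]] [P [b [bn bP Jb]]].
  exists (maxn N P), (fun i => a i + b i); split=> [i|i|].
  + by move=> /[dup] /an -> /bn ->; rewrite addr0.
  + by rewrite geq_max => /andP[/aN -> /bP ->]; rewrite addr0.
  + under eq_bigr do rewrite mulrDl.
    rewrite big_split /= (sum_ord_widen (leq_maxl N P)) //.
    by rewrite (sum_ord_widen (leq_maxr N P)) // opprD addrACA; apply: JD.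
- move=> c x [N [a [an aN Ja]]]; exists N, (fun i => c * a i); split=> [i|i|].
  + by move=> /an ->; rewrite mulr0.
  + by move=> /aN ->; rewrite mulr0.
  + under eq_bigr do rewrite -mulrA.
    by rewrite -mulr_sumr -mulrBr; apply: JM.
Qed.

(** Once the tails stabilise at n, [e n] is a combination of later members modulo J, which is a
    relation where [e n] has coefficient 1. *)
Lemma artinian_dependent : artinian R ->
  exists N (b : nat -> R), [/\ J (\sum_(i < N) b i * e i)
    & exists2 i, (i < N)%N & rho (b i) <> 0].
Proof.
move=> artR; have [J0 JD JM] := JI.
have [||n stab] := artR tail_ideal; first exact: tail_ideal_ideal.
  move=> n x [N [a [an aN Ja]]]; exists N, a; split=> // i ltin.
  exact/an/ltnW.
have [N [a [an aN Ja]]] : tail_ideal n.+1 (e n).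
  rewrite stab //; exists n.+1, (fun i => (i == n)%:R); split=> [i|i|].
  - by move=> ltin; rewrite ltn_eqF.
  - by move=> ltni; rewrite gtn_eqF.
  - rewrite big_ord_recr /= eqxx mul1r big1 ?add0r ?subrr // => i _.
    by rewrite ltn_eqF // mul0r.
pose M := maxn N n.+1; have ltnM : (n < M)%N by rewrite leq_maxr.
exists M, (fun i => (i == n)%:R - a i); split; last first.
  by exists n => //=; rewrite eqxx an // subr0 rmorph1; apply/eqP; rewrite oner_eq0.
under eq_bigr do rewrite mulrBl.
rewrite sumrB (sum_ord_widen (leq_maxl _ _)) //.
rewrite (bigD1 (Ordinal ltnM)) //= eqxx mul1r big1 ?addr0 // => i ni.
suff /negPf -> : val i != n by rewrite mul0r.
by apply: contraNneq ni => ni; apply/eqP/val_inj.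
Qed.

End InfiniteFamily.

(** Without a finite basis every independent list could be extended, and the resulting infinite
    independent family would contradict the dependence forced by the chain condition. *)
Lemma artinian_subquo_dim : artinian R -> exists n, is_subquo_dim rho I J n.
Proof.
move=> artR; apply: contrapT => nofin.
have [J0 JD JM] := JI.
have /choice[F FP] : forall s, exists e, free_mod s -> I e /\ ~ span_mod s e.
  move=> s; case: (pselect (free_mod s)) => [sf|nsf]; last by exists 0.
  apply: contrapT => noe; apply: nofin; exists (size s).
  apply: free_mod_subquo_dim => // x Ix; apply: contrapT => sx.
  by apply: noe; exists x.
pose S n := iter n (fun s => F s :: s) [::]; pose e n := F (S n).
have Sfree n : free_mod (S n).
  by elim: n => [//|n Sn] /=; have [] := FP _ Sn.
have eI n : I (e n) by have [] := FP _ (Sfree n).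
have se i n : (i < n)%N -> span_mod (S n) (e i).
  elim: n => [//|n IH]; rewrite ltnS leq_eqVlt => /predU1P[->|/IH ei] /=.
    exists 1; rewrite mul1r subrr; by have [] := span_mod_ideal (S n).
  by exists 0; rewrite mul0r subr0.
have [N [b [Jb [i ltiN]]]] := artinian_dependent e artR; apply.
elim: N i ltiN Jb => [//|N IH] i; rewrite ltnS big_ord_recr /= => leiN Jb.
have bN : rho (b N) = 0.
  have [eN nspan] := FP _ (Sfree N).
  apply: (span_mod_coef eN nspan).
  rewrite -(addKr (\sum_(i < N) b i * e i) (b N * _)) addrC.
  have sI := span_mod_ideal (S N); apply: idealB => //.
    exact: sub_span_mod.
  apply: ideal_sum => // j; have [_ _] := sI; apply; exact: se.
move: leiN; rewrite leq_eqVlt => /predU1P[-> //|/IH]; apply.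
rewrite -[X in J X](addrK (b N * e N)); apply: idealB => //.
by apply: mIJ.
Qed.

End FiniteBasis.

(** * Artinian local rings *)

Section NilpotentLocal.
Variables (k : fieldType) (R : comNzRingType) (rho : {rmorphism R -> k}).
Hypothesis rho_surj : forall c, exists x, rho x = c.
Local Notation m := (maxideal rho).
Local Notation "m ^^ n" := (ideal_pow m n) (at level 30).

Let mI : is_ideal m := maxideal_rmorph rho.
Let powI n : is_ideal (m ^^ n) := ideal_pow_ideal n mI.

(** Nakayama for a nilpotent ideal, by descending induction on the power: replacing the first factor
    of a product in m^j by its expansion modulo m^2 leaves an error in m^(j+1). *)
Lemma maxideal_gen n (e : 'I_n -> R) N : m ^^ N = [set 0] ->
  (forall i, m (e i)) ->
  (forall x, m x -> exists a : 'I_n -> R, (m ^^ 2) (x - \sum_i a i * e i)) ->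
  m = ideal_gen e.
Proof.
move=> mN eI espan.
have genI : is_ideal (ideal_gen e).
  split=> [|x y [a ->] [b ->]|c x [a ->]].
  - by exists (fun=> 0); rewrite big1 // => i _; rewrite mul0r.
  - exists (fun i => a i + b i); rewrite -big_split.
    by apply: eq_bigr => i _; rewrite mulrDl.
  - exists (fun i => c * a i); rewrite mulr_sumr.
    by apply: eq_bigr => i _; rewrite mulrA.
have [_ gD gM] := genI; have [m0 mD mM] := mI.
apply/seteqP; split=> x; last first.
  by move=> [a ->]; apply: ideal_sum => // i; apply: mM.
suff sub i : m ^^ (N - i).+1 `<=` ideal_gen e.
  move=> mx; by apply: (sub N); rewrite subnn (ideal_pow1 mI).
elim: i => [|i IH] {}x.
  move=> /(ideal_pow_le mI (leqnSn _)); rewrite subn0 mN => ->.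
  by case: genI.
(* For i >= N the truncated difference is already 0, and the claim for [i.+1] is the one for [i]. *)
have [iN|Ni] := ltnP i N; last first.
  move=> xm; apply: IH; move: xm; apply: ideal_pow_le => //.
  by move: Ni; rewrite -subn_eq0 => /eqP ->.
move=> [p [a [b [aI bI ->]]]]; apply: ideal_sum => // l.
have [c mc] := espan _ (aI l).
rewrite -(subrK (\sum_j c j * e j) (a l)) mulrDl; apply: gD.
  apply: IH; rewrite -(subnSK iN) -[_.+2]/(2 + _)%N.
  exact: ideal_powD mI mc (bI l).
by rewrite mulrC; apply: gM; exists c.
Qed.

(** A basis of m/m^2 lifts to generators of m, and any generating family of m spans m/m^2, so it is
    at least as long. *)
Lemma edimE n N : m ^^ N = [set 0] ->
  is_subquo_dim rho (m ^^ 1) (m ^^ 2) n -> edim rho = n.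
Proof.
move=> mN [e []]; rewrite (ideal_pow1 mI) => eI espan efree.
have gen_e := maxideal_gen mN eI espan.
have min_n p (g : 'I_p -> R) : m = ideal_gen g -> (n <= p)%N.
  move=> gen_g; apply: (subquo_dim_le (powI 2) efree (g := g)) => i.
    have : ideal_gen g (e i) by rewrite -gen_g.
    move=> [a ->]; exists a; rewrite subrr; by have [] := powI 2.
  apply: espan; rewrite gen_g; exists (fun j => (j == i)%:R).
  rewrite (bigD1 i) //= eqxx mul1r big1 ?addr0 // => j /negPf ->.
  exact: mul0r.
rewrite /edim; case: xgetP => [p _ [[g gen_g] minp]|/(_ n)[]].
  apply/eqP; rewrite eqn_leq (min_n _ _ gen_g) andbT.
  by apply: minp; exists e.
by split; [exists e | move=> j [g /min_n]].
Qed.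

(** A nonzero element of m^s is a socle element, so it is a multiple of the socle generator; the
    coefficient is outside m, since m kills the socle, so the generator itself lies in m^s. *)
Lemma soc_eq_pow s : is_subquo_dim rho (soc rho) [set 0] 1 ->
  m ^^ s <> [set 0] -> m ^^ s.+1 = [set 0] -> soc rho = m ^^ s.
Proof.
move=> [e [eS espan efree]] ms ms1.
have [p0 pD pM] := powI s; have [s0 sD sM] := soc_ideal rho.
have sub : m ^^ s `<=` soc rho.
  move=> x xs y my; suff : (m ^^ s.+1) (y * x) by rewrite ms1 mulrC.
  exact: ideal_mulM.
apply/seteqP; split=> // x.
have [v vs v0] : exists2 v, (m ^^ s) v & v <> 0.
  apply: contrapT => nov; apply: ms; apply/seteqP; split=> [y ys|y ->//].
  by apply: contrapT => y0; apply: nov; exists y.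
suff es : (m ^^ s) (e ord0).
  move=> /espan[a /eqP]; rewrite big_ord1 subr_eq0 => /eqP ->; exact: pM.
have [a /eqP] := espan v (sub _ vs); rewrite big_ord1 subr_eq0 => /eqP va.
have a0 : rho (a ord0) <> 0.
  by move=> ra; apply: v0; rewrite va mulrC; apply: (eS ord0).
have [b ab] := rho_unit rho_surj a0.
have -> : e ord0 = b * v + e ord0 * (1 - a ord0 * b).
  by rewrite va mulrBr mulr1 mulrA [b * _]mulrC [e _ * _]mulrC addrC subrK.
rewrite (eS ord0); first by rewrite addr0; apply: pM.
by rewrite /maxideal /= rmorphB ab rmorph1 subrr.
Qed.

(** Here s = 3 and i = 2, so x m lies in m^4 = 0 and x is in the socle, which is m^s. *)
Lemma soc_gr_short s x : m ^^ 4 = [set 0] -> m ^^ s <> [set 0] ->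
  soc rho = m ^^ s -> (2 < s)%N ->
  forall i, (2 <= i < s)%N ->
  (m ^^ i) x -> (forall y, m y -> (m ^^ i.+2) (x * y)) -> (m ^^ i.+1) x.
Proof.
move=> m4 ms socE s3 i /andP[i2 lis] xi xm.
have s4 : (s < 4)%N.
  by rewrite ltnNge; apply/negP => s4; apply: ms; apply: ideal_pow0 s4.
have -> : i.+1 = s.
  by apply/eqP; rewrite eqn_leq lis -ltnS (leq_trans s4).
rewrite -socE => y my; have := xm y my.
by rewrite (ideal_pow0 mI m4).
Qed.

(** Otherwise x generates the line m^i/m^(i+1), so m^(i+1) is contained in m^(i+2). Multiplying by
    m^(s-i-1) then gives m^s inside m^(s+1) = 0. *)
Lemma soc_gr_principal s i x : m ^^ s <> [set 0] -> m ^^ s.+1 = [set 0] ->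
  (i < s)%N -> is_subquo_dim rho (m ^^ i) (m ^^ i.+1) 1 ->
  (m ^^ i) x -> (forall y, m y -> (m ^^ i.+2) (x * y)) -> (m ^^ i.+1) x.
Proof.
move=> ms ms1 lis [e [eI espan efree]] xi xm.
have [_ pD pM] := powI i.+1; have [_ qD qM] := powI i.+2.
have [a] := espan x xi; rewrite big_ord1 => xa.
have [a0|a0] := eqVneq (rho (a ord0)) 0.
  rewrite -(subrK (a ord0 * e ord0) x); apply: pD => //.
  exact: (ideal_mulM (a0 : m (a ord0)) (eI ord0)).
exfalso; have [b ab] := rho_unit rho_surj (elimN eqP a0).
(* With b inverse to the coefficient of x modulo m, [e] agrees with b x modulo m^(i+1), so that m e
   also falls into m^(i+2). *)
pose r := e ord0 - b * x.
have rI : (m ^^ i.+1) r.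
  have -> : r = (1 - a ord0 * b) * e ord0 - b * (x - a ord0 * e ord0).
    rewrite mulrBl mul1r mulrBr opprB addrA mulrA [b * a _]mulrC subrK //.
  apply: idealB; [exact: powI | | exact: pM].
  apply: (ideal_mulM _ (eI ord0)).
  by rewrite /maxideal /= rmorphB ab rmorph1 subrr.
have em y : m y -> (m ^^ i.+2) (y * e ord0).
  move=> my; rewrite -(subrK (b * x) (e ord0)) mulrDr; apply: qD.
    exact: (@ideal_mulM _ _ (m ^^ i.+1)).
  by rewrite mulrCA; apply: qM; rewrite mulrC; apply: xm.
have step : m ^^ i.+1 `<=` m ^^ i.+2.
  move=> y [p [c [d [cI dI ->]]]]; apply: ideal_sum => // l.
  have [g] := espan _ (dI l); rewrite big_ord1 => dg.
  rewrite -(subrK (g ord0 * e ord0) (d l)) mulrDr; apply: qD.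
    exact: (@ideal_mulM _ _ (m ^^ i.+1)).
  by rewrite mulrCA; apply: qM; apply: em.
have stepD j : m ^^ (j + i.+1) `<=` m ^^ (j + i.+2).
  elim: j => [//|j IH] y; rewrite !addSn => -[p [c [d [cI dI ->]]]].
  by exists p, c, d; split=> // l; apply/IH/dI.
apply: ms; apply/seteqP; split=> [y|y ->]; last by have [] := powI s.
by rewrite -(subnK lis) => /stepD; rewrite addnS subnK // ms1.
Qed.

Lemma stretched_hilb1 i : stretched rho -> (1 < i <= loewy rho)%N ->
  is_subquo_dim rho (m ^^ i) (m ^^ i.+1) 1.
Proof.
move=> [h hP] /andP[i1 il]; apply: subquo_dim_pos.
by have := hP i il; rewrite gtn_eqF.
Qed.

End NilpotentLocal.

(** * Homogeneous components and graded subalgebras *)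

Section HomogeneousComponents.
Variables (k : fieldType) (G : gradedAlg k).
Implicit Types x y : G.

Lemma gcompB i x y : gcomp i x -> gcomp i y -> gcomp i (x - y).
Proof. by move=> xi yi; rewrite -scaleN1r; apply: gcompD => //; apply: gcompZ. Qed.

Lemma gcomp_sum i n (F : 'I_n -> G) : (forall l, gcomp i (F l)) ->
  gcomp i (\sum_l F l).
Proof.
by move=> FP; apply: (big_ind (gcomp i)) => //; [exact: gcomp_0 | exact: gcompD].
Qed.

(** [gdecomp] leaves the family unconstrained beyond its bound; setting it to zero there makes it
    unique, so choosing one defines the homogeneous components. *)
Lemma homog_decomp x : exists f : nat -> G, (forall i, gcomp i (f i)) /\
  exists N, (forall i, (N <= i)%N -> f i = 0) /\ x = \sum_(i < N) f i.
Proof.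
have [N [f [fP xE]]] := gdecomp x.
exists (fun i => if (i < N)%N then f i else 0); split=> [i|].
  by case: ifP => // _; apply: gcomp_0.
exists N; split=> [i|]; first by rewrite leqNgt => /negPf ->.
by rewrite xE; apply: eq_bigr => i _; rewrite ltn_ord.
Qed.

Definition hcomp i x : G := projT1 (cid (homog_decomp x)) i.

Lemma hcompP i x : gcomp i (hcomp i x).
Proof. by rewrite /hcomp; case: cid => f []. Qed.

Lemma hcomp_sum x : exists N, (forall i, (N <= i)%N -> hcomp i x = 0) /\
  x = \sum_(i < N) hcomp i x.
Proof. by rewrite /hcomp; case: cid => f []. Qed.

Lemma sum_ord_pad (f : nat -> G) N M : (N <= M)%N ->
  (forall i, (N <= i)%N -> f i = 0) -> \sum_(i < N) f i = \sum_(i < M) f i.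
Proof.
move=> NM f0; rewrite (big_ord_widen _ f NM) [LHS]big_mkcond.
by apply: eq_bigr => i _; case: ltnP => // /f0 ->.
Qed.

Lemma hcomp_unique (f : nat -> G) N x : (forall i, gcomp i (f i)) ->
  (forall i, (N <= i)%N -> f i = 0) -> x = \sum_(i < N) f i ->
  forall i, hcomp i x = f i.
Proof.
move=> fP f0 xE i; have [M [h0 xE']] := hcomp_sum x.
pose P := maxn (maxn N M) i.+1.
have dP j : gcomp j (hcomp j x - f j) by apply: gcompB => //; apply: hcompP.
apply/eqP; rewrite -subr_eq0; apply/eqP.
apply: (gindep (n := P) dP); last by rewrite leq_maxr.
rewrite sumrB -(sum_ord_pad (f := hcomp^~ x) (N := M)) //.
  by rewrite -(sum_ord_pad (f := f) (N := N)) -?xE -?xE' ?subrr // !leq_max leqnn.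
by rewrite !leq_max leqnn orbT.
Qed.

Lemma hcomp_linear i : linear (hcomp i).
Proof.
move=> c x y; have [N [x0 xE]] := hcomp_sum x; have [M [y0 yE]] := hcomp_sum y.
apply: (hcomp_unique (f := fun j => c *: hcomp j x + hcomp j y)
   (N := maxn N M)) => [j|j|].
- by apply: gcompD; [apply: gcompZ|]; apply: hcompP.
- by rewrite geq_max => /andP[/x0 -> /y0 ->]; rewrite scaler0 addr0.
- rewrite {1}xE {1}yE (sum_ord_pad (leq_maxl N M)) // (sum_ord_pad (leq_maxr N M)) //.
  by rewrite scaler_sumr -big_split.
Qed.
HB.instance Definition _ i :=
  GRing.isLinear.Build k G G _ (hcomp i) (hcomp_linear i).

Lemma hcomp_homog i j x : gcomp i x -> hcomp j x = if j == i then x else 0.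
Proof.
move=> xi; apply: (hcomp_unique (f := fun j => if j == i then x else 0)
  (N := i.+1)) => [{}j|{}j ij|].
- by case: eqP => [->//|_]; apply: gcomp_0.
- by rewrite gtn_eqF.
- by rewrite big_ord_recr /= eqxx big1 ?add0r // => l _; rewrite ltn_eqF.
Qed.

Lemma hcomp_id i x : gcomp i x -> hcomp i x = x.
Proof. by move=> xi; rewrite (hcomp_homog _ xi) eqxx. Qed.

Lemma hcomp_other i j x : gcomp i x -> j != i -> hcomp j x = 0.
Proof. by move=> xi /negPf ji; rewrite (hcomp_homog _ xi) ji. Qed.

Lemma hcomp_eq0 x : (forall i, hcomp i x = 0) -> x = 0.
Proof. by have [N [_ {2}->]] := hcomp_sum x => x0; rewrite big1. Qed.

Lemma hcompM n x y :
  hcomp n (x * y) = \sum_(i < n.+1) hcomp i x * hcomp (n - i) y.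
Proof.
have [N [_ xE]] := hcomp_sum x; have [M [_ yE]] := hcomp_sum y.
have eqH i j : hcomp n (hcomp i x * hcomp j y) =
    \sum_(l < n.+1) hcomp l (hcomp i x) * hcomp (n - l) (hcomp j y).
  rewrite (hcomp_homog _ (gcompM (hcompP i x) (hcompP j y))).
  case: eqP => [->|nij].
    have ilt : (i < (i + j).+1)%N by rewrite ltnS leq_addr.
    rewrite (bigD1 (Ordinal ilt)) //= addKn !(hcomp_id (hcompP _ _)).
    rewrite big1 ?addr0 // => l li.
    by rewrite (hcomp_other (hcompP i x)) ?mul0r.
  rewrite big1 // => l _.
  have [li|li] := eqVneq (val l) i; last first.
    by rewrite (hcomp_other (hcompP i x)) ?mul0r.
  rewrite [X in _ * X](hcomp_other (hcompP j y)) ?mulr0 //.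
  by apply/eqP => nlj; apply: nij; rewrite -li -nlj subnKC // -ltnS ltn_ord.
rewrite {1}xE {1}yE mulr_suml linear_sum /=.
under eq_bigr do rewrite mulr_sumr linear_sum /=.
under eq_bigr do under eq_bigr do rewrite eqH.
under eq_bigr do rewrite exchange_big /=.
rewrite exchange_big /=; apply: eq_bigr => l _.
rewrite [in RHS]xE [in RHS]yE !linear_sum /= mulr_suml; apply: eq_bigr => i _.
by rewrite mulr_sumr.
Qed.

Lemma hcomp0 x : hcomp 0 x = (aug G x)%:A.
Proof.
have [n [f [fP xE]]] := augP x.
have x0 : hcomp 0 (x - (aug G x)%:A) = 0.
  rewrite xE linear_sum big1 // => i _; exact: hcomp_other (fP i) _.
have a0 : @gcomp k G 0 (aug G x)%:A by rewrite gcomp_deg0; exists (aug G x).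
by rewrite -(hcomp_id a0); apply/eqP; rewrite -subr_eq0 -linearB /= x0.
Qed.

Lemma maxideal_augP x : maxideal (aug G) x <-> hcomp 0 x = 0.
Proof.
rewrite hcomp0; split=> [->|/eqP]; first by rewrite scale0r.
by rewrite scaler_eq0 oner_eq0 orbF => /eqP.
Qed.

Lemma hcomp1M x y :
  hcomp 1 (x * y) = aug G x *: hcomp 1 y + aug G y *: hcomp 1 x.
Proof.
rewrite hcompM 2!big_ord_recl big_ord0 addr0 /= subn0 subnn !hcomp0.
by rewrite mulr_algl mulr_algr.
Qed.

Lemma ideal_pow_hcomp n x : ideal_pow (maxideal (aug G)) n x ->
  forall i, (i < n)%N -> hcomp i x = 0.
Proof.
elim: n x => [//|n IH] x [p [a [b [aI bI ->]]]] i; rewrite ltnS => lein.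
rewrite linear_sum big1 // => l _; rewrite /= hcompM big1 // => j _.
have [->|j0] := eqVneq (val j) 0%N.
  by move/maxideal_augP: (aI l) => ->; rewrite mul0r.
rewrite [X in _ * X](IH _ (bI l)) ?mulr0 //; apply: leq_trans lein.
have jpos : (0 < j)%N by rewrite lt0n.
by rewrite ltn_subrL jpos (leq_trans jpos) // -ltnS ltn_ord.
Qed.

Lemma gcomp_maxideal i x : gcomp i.+1 x -> maxideal (aug G) x.
Proof. by move=> xi; apply/maxideal_augP/(hcomp_other xi). Qed.

Lemma soc_aug x a : soc (aug G) x -> a * x = aug G a *: x.
Proof.
move=> xs; rewrite -[a](subrK (aug G a)%:A) mulrDl mulr_algl mulrC xs ?add0r.
  by rewrite rmorphD rmorphB /= aug_alg subrr add0r.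
by rewrite /maxideal /= rmorphB /= aug_alg subrr.
Qed.

End HomogeneousComponents.

(** * Homogeneous subalgebras with the induced grading *)

Record homogSubalg (k : fieldType) (G : gradedAlg k) := HomogSubalg {
  homog_pred : {pred G};
  homog_closed : GRing.subalg_closed homog_pred;
  homog_hcomp : forall i x, x \in homog_pred -> hcomp i x \in homog_pred
}.
HB.instance Definition _ (k : fieldType) (G : gradedAlg k) (S : homogSubalg G) :=
  GRing.isSubalgClosed.Build k G (homog_pred S) (homog_closed S).

Section HomogeneousSubalgebra.
Variables (k : fieldType) (G : gradedAlg k) (S : homogSubalg G).

Record subgr := Subgr { subgr_val : G; _ : subgr_val \in homog_pred S }.
HB.instance Definition _ := [isSub for subgr_val].
HB.instance Definition _ := [Choice of subgr by <:].
HB.instance Definition _ := [SubChoice_isSubComNzRing of subgr by <:].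
HB.instance Definition _ := [SubZmodule_isSubLmodule of subgr by <:].
HB.instance Definition _ := [SubNzRing_SubLmodule_isSubLalgebra of subgr by <:].
HB.instance Definition _ := [SubLalgebra_isSubAlgebra of subgr by <:].

Definition subgr_comp (i : nat) : set subgr := [set x | gcomp i (\val x)].

Fact subgr_comp_0 i : subgr_comp i 0.
Proof. by rewrite /subgr_comp /mkset rmorph0; apply: gcomp_0. Qed.

Fact subgr_compD i x y :
  subgr_comp i x -> subgr_comp i y -> subgr_comp i (x + y).
Proof. by move=> xi yi; rewrite /subgr_comp /mkset rmorphD; apply: gcompD. Qed.

Fact subgr_compZ i c x : subgr_comp i x -> subgr_comp i (c *: x).
Proof. by move=> xi; rewrite /subgr_comp /mkset linearZ; apply: gcompZ. Qed.

Fact subgr_compM i j x y :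
  subgr_comp i x -> subgr_comp j y -> subgr_comp (i + j) (x * y).
Proof. by move=> xi yj; rewrite /subgr_comp /mkset rmorphM; apply: gcompM. Qed.

Lemma subgr_val_alg c : \val (c%:A : subgr) = c%:A.
Proof. by rewrite linearZ. Qed.

Fact subgr_comp_deg0 : subgr_comp 0 = [set c%:A | c in [set: k]].
Proof.
apply/seteqP; split => x /=; rewrite /subgr_comp /=.
  rewrite gcomp_deg0 => -[c _ cE]; exists c => //.
  by apply: val_inj; rewrite subgr_val_alg.
by move=> [c _ <-]; rewrite gcomp_deg0; exists c; rewrite // -subgr_val_alg.
Qed.

Fact subgr_decomp (x : subgr) : exists n (f : nat -> subgr),
  (forall i, subgr_comp i (f i)) /\ x = \sum_(i < n) f i.
Proof.
have [n [_ xE]] := hcomp_sum (\val x).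
exists n, (fun i => Subgr (homog_hcomp i (valP x))); split=> [i|].
  by rewrite /subgr_comp /=; apply: hcompP.
by apply: val_inj; rewrite rmorph_sum.
Qed.

Fact subgr_indep n (f : nat -> subgr) : (forall i, subgr_comp i (f i)) ->
  \sum_(i < n) f i = 0 -> forall i, (i < n)%N -> f i = 0.
Proof.
move=> fP f0 i ltin; apply: val_inj; rewrite rmorph0.
apply: (gindep (f := fun i => \val (f i))) ltin => //.
by rewrite -rmorph_sum f0 rmorph0.
Qed.

Definition subgraded : gradedAlg k :=
  GradedAlg subgr_comp_0 subgr_compD subgr_compZ subgr_compM
    subgr_comp_deg0 subgr_decomp subgr_indep.

Lemma subgraded_valM (x y : subgraded) : \val (x * y) = \val x * \val y.
Proof. exact: rmorphM. Qed.

Lemma subgraded_val0 : \val (0 : subgraded) = 0.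
Proof. exact: rmorph0. Qed.

Lemma subgraded_aug (x : subgraded) : aug subgraded x = aug G (\val x).
Proof.
have [n [f [fP xE]]] := augP x; apply/esym/aug_unique.
exists n, (fun i => \val (f i)); split=> [i|]; first exact: fP.
by rewrite -rmorph_sum -xE rmorphB /= -subgr_val_alg.
Qed.

End HomogeneousSubalgebra.

(** [soc_projM] is the Leibniz rule over the augmentation. Together with the socle condition it
    makes the kernel, and k plus the image, closed under products. *)
Record socProj (k : fieldType) (G : gradedAlg k) := SocProj {
  soc_proj :> {linear G -> G};
  soc_projM : forall x y,
    soc_proj (x * y) = aug G x *: soc_proj y + aug G y *: soc_proj x;
  soc_proj_comp : forall x, gcomp 1 (soc_proj x);
  soc_proj_soc : forall x, soc (aug G) (soc_proj x);
  soc_projK : forall x, soc_proj (soc_proj x) = soc_proj x;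
  soc_proj_hcomp : forall x, soc_proj x = soc_proj (hcomp 1 x)
}.

(* Both factors are subalgebras of G itself: the first is the kernel of the
   projection, the second is k plus its image. *)
Section FibreSplitting.
Variables (k : fieldType) (G : gradedAlg k) (pr : socProj G).

Let prM x y : pr (x * y) = aug G x *: pr y + aug G y *: pr x.
Proof. exact: soc_projM. Qed.
Let pr_comp x : gcomp 1 (pr x). Proof. exact: soc_proj_comp. Qed.
Let prK x : pr (pr x) = pr x. Proof. exact: soc_projK. Qed.
Let pr_hcomp x : pr x = pr (hcomp 1 x). Proof. exact: soc_proj_hcomp. Qed.

Lemma pr_1 : pr 1 = 0.
Proof.
have := prM 1 1; rewrite mulr1 rmorph1 scale1r => /eqP.
by rewrite -subr_eq0 opprD addNKr oppr_eq0 => /eqP.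
Qed.

Lemma pr_alg c : pr c%:A = 0.
Proof. by rewrite linearZ /= pr_1 scaler0. Qed.

Lemma aug_pr x : aug G (pr x) = 0.
Proof. exact: aug_comp (pr_comp x). Qed.

Definition ker_pred : {pred G} := fun x => pr x == 0.

Fact ker_subalg : GRing.subalg_closed ker_pred.
Proof.
split; first by rewrite unfold_in pr_1.
  move=> c x y; rewrite !unfold_in => /eqP px /eqP py.
  by rewrite linearP px py scaler0 addr0.
move=> x y; rewrite !unfold_in => /eqP px /eqP py.
by rewrite prM px py !scaler0 addr0.
Qed.

Fact ker_homog i x : x \in ker_pred -> hcomp i x \in ker_pred.
Proof.
rewrite !unfold_in => /eqP px; rewrite pr_hcomp.
rewrite (hcomp_homog _ (hcompP i x)); case: (eqVneq 1%N i) => [<-|_].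
  by rewrite -pr_hcomp px.
by rewrite linear0.
Qed.

Definition im_pred : {pred G} := fun x => pr x == x - (aug G x)%:A.

Fact im_subalg : GRing.subalg_closed im_pred.
Proof.
split; first by rewrite unfold_in pr_1 rmorph1 scale1r subrr.
  move=> c x y; rewrite !unfold_in => /eqP px /eqP py.
  rewrite linearP px py rmorphD /= aug_scale scalerDl -scalerA scalerBr.
  by rewrite opprD addrACA.
move=> x y; rewrite !unfold_in => /eqP px /eqP py.
have : x * pr y = aug G x *: pr y by apply: soc_aug (soc_proj_soc pr y).
rewrite prM => <-; rewrite px py mulrBr mulr_algr scalerBr addrA subrK.
by rewrite rmorphM /= scalerA mulrC [aug G y * _]mulrC.
Qed.

Fact im_homog i x : x \in im_pred -> hcomp i x \in im_pred.
Proof.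
rewrite !unfold_in => /eqP px.
have xE : x = (aug G x)%:A + pr x by rewrite px addrC subrK.
have a0 : @gcomp k G 0 (aug G x)%:A by rewrite gcomp_deg0; exists (aug G x).
rewrite xE linearD /= (hcomp_homog _ a0) (hcomp_homog _ (pr_comp x)).
case: i => [|[|i]] /=.
- by rewrite addr0 pr_alg aug_alg subrr.
- by rewrite add0r prK aug_pr scale0r subr0.
- by rewrite addr0 linear0 rmorph0 scale0r subr0.
Qed.

Definition ker_alg := subgraded (HomogSubalg ker_subalg ker_homog).
Definition im_alg := subgraded (HomogSubalg im_subalg im_homog).

Fact to_ker_subproof x : x - pr x \in ker_pred.
Proof. by rewrite unfold_in linearB /= prK subrr. Qed.
Definition to_ker x : ker_alg := Subgr (S := HomogSubalg _ _) (to_ker_subproof x).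

Fact to_im_subproof x : (aug G x)%:A + pr x \in im_pred.
Proof.
rewrite unfold_in linearD pr_alg add0r prK.
by rewrite rmorphD /= aug_alg aug_pr addr0 addrC addKr.
Qed.
Definition to_im x : im_alg := Subgr (S := HomogSubalg _ _) (to_im_subproof x).

Lemma to_ker_linear : linear to_ker.
Proof.
move=> c x y; apply: val_inj; rewrite linearP /=.
by rewrite linearP opprD addrACA -scalerBr.
Qed.
HB.instance Definition _ :=
  GRing.isLinear.Build k G ker_alg _ to_ker to_ker_linear.

Lemma to_im_linear : linear to_im.
Proof.
move=> c x y; apply: val_inj; rewrite linearP /=.
by rewrite linearP rmorphD /= aug_scale scalerDl scalerDr -scalerA addrACA.
Qed.
HB.instance Definition _ :=
  GRing.isLinear.Build k G im_alg _ to_im to_im_linear.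

Lemma mul_pr x y : x * pr y = aug G x *: pr y.
Proof. exact: soc_aug (soc_proj_soc pr y). Qed.

(** In (x - pr x)(y - pr y) a socle factor sees the other factor only through its augmentation and
    pr x pr y = 0, so the cross terms add up to [pr (x * y)]. *)
Lemma to_ker_monoid_morphism : monoid_morphism to_ker.
Proof.
split=> [|x y]; apply: val_inj; first by rewrite rmorph1 /= pr_1 subr0.
rewrite rmorphM /= prM mulrBl !mulrBr !mul_pr aug_pr scale0r subr0.
by rewrite [pr x * y]mulrC mul_pr opprD addrA.
Qed.
HB.instance Definition _ :=
  GRing.isMonoidMorphism.Build G ker_alg to_ker to_ker_monoid_morphism.

Lemma to_im_monoid_morphism : monoid_morphism to_im.
Proof.
split=> [|x y]; apply: val_inj.
  by rewrite rmorph1 /= pr_1 addr0 rmorph1 scale1r.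
rewrite rmorphM /= prM mulrDl !mulrDr !mul_pr aug_pr scale0r addr0.
rewrite [pr x * _]mulrC mulr_algl aug_alg rmorphM /= addrA.
by rewrite mulr_algl scalerA.
Qed.
HB.instance Definition _ :=
  GRing.isMonoidMorphism.Build G im_alg to_im to_im_monoid_morphism.

Lemma to_ker_surj y : exists x, to_ker x = y.
Proof.
exists (val y); apply: val_inj; rewrite /=.
by have /eqP -> := valP y; rewrite subr0.
Qed.

Lemma to_im_surj y : exists x, to_im x = y.
Proof.
exists (val y); apply: val_inj; rewrite /=.
by have /eqP -> := valP y; rewrite addrC subrK.
Qed.

Fact to_fibre_subproof x : (to_ker x, to_im x) \in @fibre_pred k ker_alg im_alg.
Proof.
rewrite unfold_in /= !subgraded_aug /= rmorphB rmorphD /=.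
by rewrite aug_alg aug_pr subr0 addr0.
Qed.
Definition to_fibre x : fibre_product ker_alg im_alg :=
  Fibre (to_fibre_subproof x).

Lemma to_fibre_linear : linear to_fibre.
Proof.
move=> c x y; apply: val_inj; rewrite linearP /=.
by rewrite !linearP.
Qed.
HB.instance Definition _ :=
  GRing.isLinear.Build k G (fibre_product ker_alg im_alg) _ to_fibre
    to_fibre_linear.

Lemma to_fibre_monoid_morphism : monoid_morphism to_fibre.
Proof.
split=> [|x y]; apply: val_inj; first by rewrite rmorph1 /= !rmorph1.
by rewrite rmorphM /= !rmorphM.
Qed.
HB.instance Definition _ :=
  GRing.isMonoidMorphism.Build G (fibre_product ker_alg im_alg) to_fibre
    to_fibre_monoid_morphism.

(** The two entries share their constant term, which their sum counts twice. *)
Definition of_fibre (z : fibre_product ker_alg im_alg) : G :=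
  val (val z).1 + val (val z).2 - (aug G (val (val z).1))%:A.

Lemma to_fibreK : cancel to_fibre of_fibre.
Proof.
move=> x; rewrite /of_fibre /= rmorphB /= aug_pr subr0.
by rewrite addrA addrAC addrK subrK.
Qed.

Lemma of_fibreK : cancel of_fibre to_fibre.
Proof.
case=> -[a b] abP; have := abP; rewrite unfold_in /= !subgraded_aug => /eqP ab.
have /eqP pa := valP a; have /eqP pb := valP b; rewrite /= in ab pa pb.
pose x := of_fibre (Fibre abP).
have xE : x = subgr_val a + subgr_val b - (aug G (subgr_val a))%:A by [].
have px : pr x = subgr_val b - (aug G (subgr_val a))%:A.
  by rewrite xE linearB linearD /= pr_alg subr0 pa pb ab add0r.
apply: val_inj; rewrite -/x /=; congr (_, _); apply: val_inj => /=.
  by rewrite px xE -(addrA (subgr_val a)) addrK.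
by rewrite px xE rmorphB rmorphD /= aug_alg -ab addrK addrC subrK.
Qed.

Lemma hcomp_gcomp i j (x : G) : gcomp i x -> gcomp i (hcomp j x).
Proof.
by move=> xi; rewrite (hcomp_homog _ xi); case: eqP => // _; apply: gcomp_0.
Qed.

Lemma pr_gcomp i (x : G) : gcomp i x -> gcomp i (pr x).
Proof.
move=> xi; rewrite pr_hcomp (hcomp_homog _ xi).
by case: eqP => [<-|_]; rewrite ?linear0; [apply: pr_comp | apply: gcomp_0].
Qed.

Lemma fibre_splitting : graded_iso G (fibre_product ker_alg im_alg).
Proof.
exists to_fibre; split; first by exists of_fibre; [exact: to_fibreK | exact: of_fibreK].
move=> i x; split=> [xi|[/= ai bi]].
  split=> /=; rewrite /subgr_comp /=.
    by apply: gcompB => //; apply: pr_gcomp.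
  by apply: gcompD; [rewrite -hcomp0; apply: hcomp_gcomp | apply: pr_gcomp].
rewrite -[x]to_fibreK /of_fibre -hcomp0; apply: gcompB; last exact: hcomp_gcomp.
exact: gcompD.
Qed.

End FibreSplitting.

(** * Splitting off the degree one socle *)

Section FiniteDimensional.
Variables (k : fieldType) (A : comAlgType k).

Fixpoint kspan (g : seq A) : set A :=
  if g is e :: g' then [set x | exists c, kspan g' (x - c *: e)] else [set 0].

Lemma kspan0 g : kspan g 0.
Proof. by elim: g => [//|e g IH] /=; exists 0; rewrite scale0r subr0. Qed.

Lemma kspan_lin g c x y : kspan g x -> kspan g y -> kspan g (c *: x + y).
Proof.
elim: g x y => [|e g IH] x y /=; first by move=> -> ->; rewrite scaler0 addr0.
move=> [a ax] [b bx]; exists (c * a + b).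
by rewrite scalerDl -scalerA opprD addrACA -scalerBr; apply: IH.
Qed.

Lemma kspan_cat g g' x y : kspan g x -> kspan g' y -> kspan (g ++ g') (x + y).
Proof.
elim: g x => [|e g IH] x /=; first by move=> ->; rewrite add0r.
by move=> [c cx] gy; exists c; rewrite addrAC; apply: IH.
Qed.

Lemma kspan_mem n (g : 'I_n -> A) (c : 'I_n -> k) :
  kspan (codom g) (\sum_i c i *: g i).
Proof.
have -> : codom g = map g (enum 'I_n) by [].
rewrite -big_enum /=; elim: (enum 'I_n) => [|i l IH] /=; first by rewrite big_nil.
by exists (c i); rewrite big_cons addrAC subrr add0r.
Qed.

(** By induction on the generators: the part of the chain inside the span of the tail stabilises,
    and it remains to follow the coefficient on the head [e]. *)
Lemma kspan_chain_stable g (I : nat -> set A) :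
  (forall n c x y, I n x -> I n y -> I n (c *: x + y)) ->
  (forall n, I n.+1 `<=` I n) -> (forall n, I n `<=` kspan g) ->
  exists n, forall j, (n <= j)%N -> I n `<=` I j.
Proof.
elim: g I => [|e g IH] I Ilin Idec Isub.
  (* The hypotheses allow an empty [I n], so it must be decided whether 0 stays in the chain. *)
  have [[n In0]|I0] := pselect (exists n, ~ I n 0).
    exists n => j _ x Ix; exfalso; apply: In0.
    by have -> : 0 = x; first exact/esym/(Isub n).
  exists 0%N => j _ x /Isub /= ->; apply: contrapT => Ij.
  by apply: I0; exists j.
have Idecr i j : (i <= j)%N -> I j `<=` I i.
  by move=> /subnK <-; elim: (j - i)%N => [//|d IHd] x /Idec /IHd.
have [||//|n nP] := IH (fun n => I n `&` kspan g).
- by move=> n c x y [Ix gx] [Iy gy]; split; [apply: Ilin | apply: kspan_lin].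
- by move=> n x [/Idec].
(* If [lead p] fails, members of [I j] for j >= p have coefficient 0 on [e], as a nonzero one could
   be scaled to 1. If it never fails, an element of [I j] with coefficient 1 cancels the head. *)
pose lead n := exists2 z, I n z & kspan g (z - e).
have [[p pN]|noP] := pselect (exists p, ~ lead p).
  exists (maxn n p) => j; rewrite geq_max => /andP[nj pj] x Ix.
  have [c cx] := Isub _ _ Ix.
  have [c0|c0] := eqVneq c 0.
    have gx : kspan g x by move: cx; rewrite c0 scale0r subr0.
    by have [] := nP j nj x (conj (Idecr _ _ (leq_maxl n p) _ Ix) gx).
  exfalso; apply: pN; exists (c^-1 *: x).
    have Ipx := Idecr _ _ (leq_maxr n p) _ Ix.
    rewrite -[_ *: _]addr0 -(addNr x) -scaleN1r; apply: (Ilin) => //.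
    exact: Ilin.
  have -> : c^-1 *: x - e = c^-1 *: (x - c *: e) + 0.
    by rewrite scalerBr scalerA mulVf // scale1r addr0.
  by apply: kspan_lin => //; apply: kspan0.
exists n => j nj x Ix; have [c cx] := Isub _ _ Ix.
have [z Iz ze] : lead j by apply: contrapT => jN; apply: noP; exists j.
have IB : I n (- c *: z + x) by apply: (Ilin) => //; apply: Idecr nj _ Iz.
have gB : kspan g (- c *: z + x).
  have -> : - c *: z + x = - c *: (z - e) + (x - c *: e).
    by rewrite scalerBr !scaleNr opprK addrA addrAC addrK.
  exact: kspan_lin.
have [Ij _] := nP j nj _ (conj IB gB).
have -> : x = c *: z + (- c *: z + x) by rewrite scaleNr addrA subrr add0r.
exact: Ilin.
Qed.

Lemma findim_artinian g : (forall x, kspan g x) -> artinian A.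
Proof.
move=> gspan I II Idec.
have [|//||n nP] := @kspan_chain_stable g I; last 1 first.
- exists n => j nj; apply/seteqP; split; last exact: nP.
  by move: nj => /subnK <-; elim: (j - n)%N => [//|d IHd] x /Idec /IHd.
- move=> n c x y Ix Iy; have [_ ID IM] := II n.
  by apply: ID => //; rewrite -[c *: x]mulr_algl; apply: IM.
- by move=> n x _.
Qed.

End FiniteDimensional.

Lemma graded_artinian (k : fieldType) (G : gradedAlg k) (s : nat) :
  (forall i (x : G), (s < i)%N -> gcomp i x -> x = 0) ->
  (forall i, exists n (g : 'I_n -> G), forall x, gcomp i x ->
    exists c : 'I_n -> k, x = \sum_j c j *: g j) ->
  artinian G.
Proof.
move=> Gs Gfin.
have fin n : exists g : seq G, forall f : nat -> G, (forall i, gcomp i (f i)) ->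
    kspan g (\sum_(i < n) f i).
  elim: n => [|n [g gP]]; first by exists [::] => f _; rewrite big_ord0.
  have [p [e eP]] := Gfin n; exists (g ++ codom e) => f fP.
  rewrite big_ord_recr /=; apply: kspan_cat; first exact: gP.
  by have [c ->] := eP _ (fP n); apply: kspan_mem.
have [g gP] := fin s.+1; apply: (@findim_artinian _ _ g) => x.
have -> : x = \sum_(i < s.+1) hcomp i x; last by apply: gP => i; apply: hcompP.
apply/eqP; rewrite -subr_eq0; apply/eqP/hcomp_eq0 => i.
rewrite linearB linear_sum /=; have [si|si] := ltnP s i.
  rewrite (Gs i _ si (hcompP i x)) big1 ?subr0 // => j _.
  by rewrite (hcomp_other (hcompP j x)) // gtn_eqF // (leq_trans (ltn_ord j)).
rewrite (bigD1 (Ordinal (si : (i < s.+1)%N))) //= (hcomp_id (hcompP _ _)).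
rewrite big1 ?addr0 ?subrr // => j ji.
by rewrite (hcomp_other (hcompP j x)) // eq_sym.
Qed.

(** * The socle of a standard graded algebra and the pairing of G_1 with G_(s-1) *)

Section SocleOfStandardGraded.
Variables (k : fieldType) (G : gradedAlg k) (s : nat) (u : G).
Hypothesis s_ge3 : (2 < s)%N.
Hypothesis G_top : forall i (x : G), (s < i)%N -> gcomp i x -> x = 0.
Hypothesis us : gcomp s u.
Hypothesis u0 : u <> 0.
Hypothesis u_span : forall x : G, gcomp s x -> exists c, x = c *: u.
Hypothesis G_std : forall i (x : G),
  gcomp i.+1 x -> ideal_mul (@gcomp k G 1) (gcomp i) x.
Hypothesis G_soc : forall i (x : G), (1 < i < s)%N -> gcomp i x ->
  (forall y, gcomp 1 y -> x * y = 0) -> x = 0.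
Variables (h t : nat) (E : 'I_h -> G) (F : 'I_t -> G).
Hypothesis E1 : forall i, gcomp 1 (E i).
Hypothesis E_span : forall x : G, gcomp 1 x -> exists c : 'I_h -> k,
  x = \sum_i c i *: E i.
Hypothesis E_free : forall c : 'I_h -> k, \sum_i c i *: E i = 0 ->
  forall i, c i = 0.
Hypothesis Fs : forall i, gcomp s.-1 (F i).
Hypothesis F_span : forall x : G, gcomp s.-1 x -> exists c : 'I_t -> k,
  x = \sum_i c i *: F i.
Hypothesis F_free : forall c : 'I_t -> k, \sum_i c i *: F i = 0 ->
  forall i, c i = 0.

Local Notation mG := (maxideal (aug G)).
Local Notation socG := (soc (aug G)).

Let predsK : s.-1.+1 = s. Proof. by rewrite prednK // (leq_trans _ s_ge3). Qed.

Lemma scale_u_inj c d : c *: u = d *: u -> c = d.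
Proof.
move=> /eqP; rewrite -subr_eq0 -scalerBl scaler_eq0 subr_eq0.
by move=> /orP[/eqP//|/eqP].
Qed.

Lemma gcomp_ideal_pow i (x : G) : gcomp i x -> ideal_pow mG i x.
Proof.
elim: i x => [//|i IH] x /G_std[n [a [b [aI bI ->]]]].
exists n, a, b; split=> // l; first exact: gcomp_maxideal (aI l).
exact: IH.
Qed.

Lemma u_maxideal : mG u.
Proof. by move: us; rewrite -predsK; apply: gcomp_maxideal. Qed.

Lemma soc_of_comp (x : G) : (forall i y, gcomp i.+1 y -> x * y = 0) -> socG x.
Proof.
move=> x0 y /maxideal_augP y0; have [N [_ ->]] := hcomp_sum y.
rewrite mulr_sumr big1 // => -[[|i] /= _] _; first by rewrite y0 mulr0.
exact: x0 (hcompP _ _).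
Qed.

Lemma soc_of_degree1 (x : G) : (forall y, gcomp 1 y -> x * y = 0) -> socG x.
Proof.
move=> x0; apply: soc_of_comp => i y /G_std[n [a [b [aI _ ->]]]].
by rewrite mulr_sumr big1 // => l _; rewrite mulrA x0 // mul0r.
Qed.

Lemma top_soc (x : G) : gcomp s x -> socG x.
Proof.
move=> xs; apply: soc_of_comp => i y yi.
by apply: G_top (gcompM xs yi); rewrite -addSnnS leq_addr.
Qed.

Lemma hcompMr i j (x y : G) : gcomp j y ->
  hcomp (i + j) (x * y) = hcomp i x * y.
Proof.
move=> yj; have ilt : (i < (i + j).+1)%N by rewrite ltnS leq_addr.
rewrite hcompM (bigD1 (Ordinal ilt)) //= addKn (hcomp_id yj).
rewrite big1 ?addr0 // => l li; rewrite (hcomp_other yj) ?mulr0 //.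
apply: contra_neq li => lj; apply/val_inj/(@addIn j) => /=.
have lle : (l <= i + j)%N by rewrite -ltnS ltn_ord.
by rewrite -[RHS](subnKC lle) lj.
Qed.

Lemma soc_hcompM (x y : G) i : socG x -> gcomp 1 y -> hcomp i x * y = 0.
Proof.
move=> xs y1; rewrite -(hcompMr _ _ y1) xs ?linear0 //.
exact: gcomp_maxideal y1.
Qed.

(** A nonzero constant term would act on the socle element [u] as a nonzero scalar, although x kills
    [u]. *)
Lemma soc_maxideal (x : G) : socG x -> aug G x = 0.
Proof.
move=> xs; have : x * u = aug G x *: u.
  by rewrite mulrC; have := soc_aug x (top_soc us); rewrite mulrC.
rewrite (xs _ u_maxideal) => /esym/eqP; rewrite scaler_eq0.
by move=> /orP[/eqP//|/eqP].
Qed.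

(** Multiplying by a degree one element shifts all components by one, so each component of a socle
    element is itself killed by G_1. *)
Lemma soc_decomp (x : G) : socG x ->
  x = hcomp 1 x + hcomp s x /\ socG (hcomp 1 x).
Proof.
move=> xs; split; last by apply: soc_of_degree1 => y; apply: soc_hcompM.
apply/eqP; rewrite -subr_eq0; apply/eqP/hcomp_eq0 => i.
rewrite linearB linearD /= (hcomp_homog _ (hcompP 1 x)).
rewrite (hcomp_homog _ (hcompP s x)).
have [->|i1] := eqVneq i 1%N.
  by rewrite ltn_eqF ?addr0 ?subrr // (ltn_trans _ s_ge3).
have [->|i_s] := eqVneq i s; first by rewrite add0r subrr.
rewrite addr0 subr0; case: i i1 i_s => [|[//|i]] _ i_s.
  by rewrite hcomp0 soc_maxideal // scale0r.
have [si|si] := ltnP s i.+2; first exact: G_top si (hcompP _ _).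
apply: (G_soc _ (hcompP _ _)) => [|y]; last exact: soc_hcompM.
by rewrite /= ltn_neqAle i_s.
Qed.

Fact topcoef_subproof x : exists c, hcomp s x = c *: u.
Proof. exact/u_span/hcompP. Qed.

Definition topcoef x : k := projT1 (cid (topcoef_subproof x)).

Lemma topcoefP x : hcomp s x = topcoef x *: u.
Proof. exact: projT2 (cid (topcoef_subproof x)). Qed.

Lemma topcoefE (x : G) : gcomp s x -> x = topcoef x *: u.
Proof. by move=> xs; rewrite -topcoefP hcomp_id. Qed.

Lemma topcoef_linear : linear_for *%R topcoef.
Proof.
move=> c x y; apply: scale_u_inj.
by rewrite -topcoefP linearP /= scalerDl -scalerA -!topcoefP.
Qed.
HB.instance Definition _ := GRing.isLinear.Build k G k *%R topcoef topcoef_linear.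

Lemma mul_top (x y : G) : gcomp 1 x -> gcomp s.-1 y -> gcomp s (x * y).
Proof. by move=> x1 ys; rewrite -predsK -add1n; apply: gcompM. Qed.

Lemma soc_of_pairing (x : G) : gcomp 1 x -> (forall j, x * F j = 0) -> socG x.
Proof.
move=> x1 xF; apply: soc_of_degree1.
(* The descent stops at d = s - 2, where y has degree 1; every new product then has degree between 2
   and s - 2, inside the range of [G_soc]. *)
suff xd d y : (d <= s - 2)%N -> gcomp (s.-1 - d) y -> x * y = 0.
  move=> y y1; apply: (xd (s - 2)%N) => //.
  by have -> : (s.-1 - (s - 2) = 1)%N by lia.
elim: d y => [|d IH] y ds yd.
  move: yd; rewrite subn0 => /F_span[c ->].
  by rewrite mulr_sumr big1 // => j _; rewrite -scalerAr xF scaler0.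
apply: (G_soc (i := (s.-1 - d)%N)).
- lia.
- have -> : (s.-1 - d = 1 + (s.-1 - d.+1))%N by lia.
  exact: gcompM.
- move=> z z1; rewrite -mulrA; apply: IH; first exact: ltnW.
  have -> : (s.-1 - d = s.-1 - d.+1 + 1)%N by lia.
  exact: gcompM.
Qed.

Definition pairing_mx : 'M[k]_(h, t) := \matrix_(i, j) topcoef (E i * F j).
Local Notation B := pairing_mx.

Lemma pairing_mxE i j : E i * F j = B i j *: u.
Proof. by rewrite mxE -topcoefE //; apply: mul_top. Qed.

(** A relation among the columns of [B] gives an element of G_(s-1) killed by G_1, which is zero
    because s - 1 >= 2. *)
Lemma pairing_row_full : row_full B.
Proof.
suff : row_free B^T by rewrite /row_free /row_full mxrank_tr.
apply: inj_row_free => v vB.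
pose z := \sum_j v 0 j *: F j.
have z0 : z = 0.
  apply: (G_soc (i := s.-1)).
  - by case: s s_ge3 => [|n] //=; rewrite !ltnS leqnn andbT.
  - by apply: gcomp_sum => j; apply: gcompZ.
  - move=> y /E_span[c ->]; rewrite mulr_sumr big1 // => i _.
    rewrite -scalerAr mulrC mulr_sumr.
    suff -> : \sum_j E i * (v 0 j *: F j) = (v *m B^T) 0 i *: u.
      by rewrite vB mxE scale0r scaler0.
    rewrite mxE scaler_suml; apply: eq_bigr => j _.
    by rewrite -scalerAr pairing_mxE scalerA [B^T _ _]mxE.
by apply/rowP => j; rewrite [RHS]mxE; apply: F_free z0 j.
Qed.

(** The rows of a left inverse of [B] give elements of G_1 dual to the [F j]; they span a complement
    of the degree one socle. *)
Definition dual_elt j : G := \sum_i pinvmx B j i *: E i.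

Lemma dual_eltM j l : dual_elt j * F l = (j == l)%:R *: u.
Proof.
rewrite mulr_suml; under eq_bigr do rewrite -scalerAl pairing_mxE scalerA.
rewrite -scaler_suml; congr (_ *: u).
transitivity ((pinvmx B *m B) j l); first by rewrite mxE.
by rewrite mulVpmx ?pairing_row_full // mxE.
Qed.

(* Subtracting the part of x_1 seen by the pairing with G_(s-1) leaves an element
   of the socle. *)
Definition soc1_proj (x : G) : G :=
  hcomp 1 x - \sum_j topcoef (hcomp 1 x * F j) *: dual_elt j.

Lemma soc1_proj_linear : linear soc1_proj.
Proof.
move=> c x y; rewrite /soc1_proj linearP /=.
have -> : \sum_j topcoef ((c *: hcomp 1 x + hcomp 1 y) * F j) *: dual_elt j =
    c *: (\sum_j topcoef (hcomp 1 x * F j) *: dual_elt j) +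
    \sum_j topcoef (hcomp 1 y * F j) *: dual_elt j.
  rewrite scaler_sumr -big_split; apply: eq_bigr => j _ /=.
  by rewrite mulrDl -scalerAl linearP /= scalerDl scalerA.
by rewrite opprD addrACA scalerBr.
Qed.
HB.instance Definition _ :=
  GRing.isLinear.Build k G G _ soc1_proj soc1_proj_linear.

Lemma dual_elt1 j : gcomp 1 (dual_elt j).
Proof. by apply: gcomp_sum => i; apply: gcompZ. Qed.

Lemma soc1_proj_comp x : gcomp 1 (soc1_proj x).
Proof.
apply: gcompB; first exact: hcompP.
by apply: gcomp_sum => j; apply: gcompZ; apply: dual_elt1.
Qed.

Lemma soc1_proj_soc x : socG (soc1_proj x).
Proof.
apply: soc_of_pairing (soc1_proj_comp x) _ => l.
rewrite mulrBl mulr_suml (bigD1 l) //= -scalerAl dual_eltM eqxx scale1r.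
rewrite big1 ?addr0 => [|j /negPf jl].
  by rewrite -topcoefE ?subrr //; apply: mul_top => //; apply: hcompP.
by rewrite -scalerAl dual_eltM jl scale0r scaler0.
Qed.

Lemma F_maxideal j : mG (F j).
Proof.
have := Fs j; case: s s_ge3 => [|[|n]] //= _; exact: gcomp_maxideal.
Qed.

Lemma soc1_proj_id (x : G) : gcomp 1 x -> socG x -> soc1_proj x = x.
Proof.
move=> x1 xs; rewrite /soc1_proj hcomp_id // big1 ?subr0 // => j _.
by rewrite (xs _ (F_maxideal j)) linear0 scale0r.
Qed.

Lemma soc1_projK x : soc1_proj (soc1_proj x) = soc1_proj x.
Proof. exact: soc1_proj_id (soc1_proj_comp x) (soc1_proj_soc x). Qed.

Lemma soc1_proj_hcomp x : soc1_proj x = soc1_proj (hcomp 1 x).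
Proof. by rewrite /soc1_proj (hcomp_id (hcompP 1 x)). Qed.

Lemma soc1_projM x y : soc1_proj (x * y) =
  aug G x *: soc1_proj y + aug G y *: soc1_proj x.
Proof.
rewrite soc1_proj_hcomp hcomp1M linearD !linearZ /=.
by rewrite -!soc1_proj_hcomp.
Qed.

Lemma soc_pow2_dim : is_subquo_dim (aug G) (socG `&` ideal_pow mG 2) [set 0] 1.
Proof.
exists (fun=> u); split=> [_|x [xs x2]|a].
- split; first exact: top_soc.
  apply: ideal_pow_le (maxideal_rmorph _) _ _ (gcomp_ideal_pow us).
  exact: ltnW.
- have [xE _] := soc_decomp xs; exists (fun=> (topcoef x)%:A).
  rewrite big_ord1 mulr_algl -topcoefP {1}xE (ideal_pow_hcomp x2) //.
  by rewrite add0r subrr.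
- rewrite big_ord1 (soc_aug _ (top_soc us)) => /eqP.
  rewrite scaler_eq0 => /orP[/eqP a0 i|/eqP//].
  by rewrite (ord1 i).
Qed.

Local Notation r := (\rank (kermx B)).

Lemma soc1_coordP (c : 'rV[k]_h) :
  socG (\sum_i c 0 i *: E i) <-> (c <= kermx B)%MS.
Proof.
have mulF j : (\sum_i c 0 i *: E i) * F j = (c *m B) 0 j *: u.
  rewrite mulr_suml mxE scaler_suml; apply: eq_bigr => i _.
  by rewrite -scalerAl pairing_mxE scalerA.
split=> [cs|/sub_kermxP cB].
  apply/sub_kermxP/rowP => j; rewrite [RHS]mxE; apply: scale_u_inj.
  by rewrite -mulF cs ?scale0r //; apply: F_maxideal.
apply: soc_of_pairing => [|j]; last by rewrite mulF cB mxE scale0r.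
by apply: gcomp_sum => i; apply: gcompZ.
Qed.

Lemma E_coord (x : G) : gcomp 1 x -> exists c : 'rV_h, x = \sum_i c 0 i *: E i.
Proof.
move=> /E_span[c ->]; exists (\row_i c i).
by apply: eq_bigr => i _; rewrite mxE.
Qed.

Lemma E_coord_free (c : 'rV_h) : \sum_i c 0 i *: E i = 0 -> c = 0.
Proof. by move=> c0; apply/rowP => i; rewrite [RHS]mxE; apply: E_free c0 i. Qed.

(** The basis has [u] at index 0, followed by the degree one elements whose coordinates form a basis
    of the left kernel of [B]. *)
Lemma soc_dim : is_subquo_dim (aug G) socG [set 0] r.+1.
Proof.
pose rb := row_base (kermx B).
pose n l : G := \sum_i row l rb 0 i *: E i.
have n1 l : gcomp 1 (n l) by apply: gcomp_sum => i; apply: gcompZ.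
have ns l : socG (n l).
  by apply/soc1_coordP; rewrite (submx_trans (row_sub _ _)) // eq_row_base.
have nE (d : 'rV_r) : \sum_l d 0 l *: n l = \sum_i (d *m rb) 0 i *: E i.
  under eq_bigr do rewrite scaler_sumr; rewrite exchange_big /=.
  apply: eq_bigr => i _; rewrite mxE scaler_suml; apply: eq_bigr => l _.
  by rewrite scalerA mxE.
exists (fun l => if unlift ord0 l is Some l' then n l' else u); split.
- by move=> l; case: unliftP => [l'|] _; [apply: ns | apply: top_soc].
- move=> x xs; have [xE x1s] := soc_decomp xs.
  have [c cE] := E_coord (hcompP 1 x).
  have : (c <= rb)%MS by rewrite eq_row_base; apply/soc1_coordP; rewrite -cE.
  move=> /submxP[d dE]; rewrite dE -nE in cE.
  exists (fun l => (if unlift ord0 l is Some l' then d 0 l' else topcoef x)%:A).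
  rewrite big_ord_recl /= unlift_none mulr_algl -topcoefP.
  under eq_bigr do rewrite liftK mulr_algl.
  by rewrite -cE [_ + hcomp 1 x]addrC -xE subrr.
- move=> a; rewrite big_ord_recl /= unlift_none (soc_aug _ (top_soc us)).
  under eq_bigr do rewrite liftK (soc_aug _ (ns _)).
  set y := \sum_(i < _) _ => auy.
  have y1 : gcomp 1 y by apply: gcomp_sum => l; apply: gcompZ.
  (* The degree s component isolates the coefficient of [u], since s differs from 1. *)
  have a0 : aug G (a ord0) = 0.
    move/(congr1 (hcomp s)): auy.
    rewrite linearD linear0 linearZ /= (hcomp_id us) (hcomp_other y1) ?addr0.
      by move=> /eqP; rewrite scaler_eq0 => /orP[/eqP//|/eqP].
    by rewrite gtn_eqF // (ltn_trans _ s_ge3).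
  move: auy; rewrite a0 scale0r add0r => y0 l.
  case: (unliftP ord0 l) => [l' ->|-> //].
  pose d := \row_l aug G (a (lift ord0 l)) : 'rV_r.
  have : d *m rb = 0.
    apply: E_coord_free; rewrite -nE -[RHS]y0.
    by apply: eq_bigr => l1 _; rewrite mxE.
  move=> /eqP; rewrite mulmx_free_eq0 ?row_base_free // => /eqP /rowP/(_ l').
  by rewrite !mxE.
Qed.

Lemma soc_dim_sub : r = (h - t)%N /\ (t <= h)%N.
Proof.
have /eqP rB := pairing_row_full.
by rewrite mxrank_ker rB; split=> //; rewrite -rB rank_leq_row.
Qed.

Lemma soc1_eq0 : (forall x : G, gcomp 1 x -> socG x -> x = 0) <-> r = 0%N.
Proof.
split=> [soc0|/eqP].
  apply/eqP; rewrite mxrank_eq0; apply/eqP/row_matrixP => i; rewrite row0.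
  apply/E_coord_free/soc0; last exact/soc1_coordP/row_sub.
  by apply: gcomp_sum => j; apply: gcompZ.
rewrite mxrank_eq0 => /eqP K0 x /E_coord[c ->] /soc1_coordP.
rewrite K0 submx0 => /eqP ->; rewrite big1 // => i _.
by rewrite mxE scale0r.
Qed.

(** * The two factors: Gorenstein property and Loewy lengths *)

Hypothesis G_art : artinian G.

Lemma gorenstein_gr : gorenstein (aug G) <-> r = 0%N.
Proof.
have cmE := subquo_dimE (@zero_ideal G) soc_dim.
split=> [[_]|r0]; first by rewrite /cmtype cmE => -[].
by split=> //; rewrite /cmtype cmE r0.
Qed.

Definition soc1_socProj : socProj G :=
  SocProj soc1_projM soc1_proj_comp soc1_proj_soc soc1_projK soc1_proj_hcomp.

Let gor_factor := ker_alg soc1_socProj.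
Let to_gor : {rmorphism G -> gor_factor} := @to_ker k G soc1_socProj.

Lemma val_to_gor x : \val (to_gor x) = x - soc1_proj x.
Proof. by []. Qed.

Lemma soc1_proj_val (x : gor_factor) : soc1_proj (\val x) = 0.
Proof. exact/eqP/(valP x). Qed.

Lemma gor_factor_aug (x : gor_factor) : aug gor_factor x = aug G (\val x).
Proof. exact: subgraded_aug. Qed.

Lemma soc1_proj_u : soc1_proj u = 0.
Proof.
rewrite soc1_proj_hcomp (hcomp_other us) ?linear0 //.
by rewrite ltn_eqF // (ltn_trans _ s_ge3).
Qed.

Lemma val_to_gor_u : \val (to_gor u) = u.
Proof. by rewrite val_to_gor soc1_proj_u subr0. Qed.

Lemma pow_top_eq0 : ideal_pow mG s.+1 = [set 0].
Proof.
apply/seteqP; split=> [x xs|x ->]; last first.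
  by have [] := ideal_pow_ideal s.+1 (maxideal_rmorph (aug G)).
apply: hcomp_eq0 => i; have [si|si] := ltnP s i.
  exact: G_top si (hcompP _ _).
exact: ideal_pow_hcomp xs _ _.
Qed.

(** The projection kills [u], which has degree s and not 1, so [u] survives in the s-th power of the
    maximal ideal of the factor. *)
Lemma gor_factor_loewy : loewy (aug gor_factor) = s.
Proof.
apply: loewyE => [pow0|].
  have : ideal_pow (maxideal (aug gor_factor)) s (to_gor u).
    apply: ideal_pow_morph (gcomp_ideal_pow us) => y my.
    rewrite /maxideal /= gor_factor_aug val_to_gor rmorphB /= my.
    by rewrite (aug_comp (soc1_proj_comp y)) subr0.
  rewrite pow0 => /(congr1 val); rewrite val_to_gor_u => uE.
  by apply: u0; rewrite uE subgraded_val0.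
apply/seteqP; split=> [x xs|x ->]; last first.
  by have [] := ideal_pow_ideal s.+1 (maxideal_rmorph (aug gor_factor)).
apply: val_inj; rewrite [RHS]subgraded_val0.
have : ideal_pow mG s.+1 (val x).
  apply: (ideal_pow_morph (f := val : {rmorphism gor_factor -> G})) xs => y.
  by rewrite /maxideal /= gor_factor_aug.
by rewrite pow_top_eq0.
Qed.

Lemma to_gor_u_neq0 : to_gor u <> 0.
Proof.
move=> /(congr1 val); rewrite val_to_gor_u => uE.
by apply: u0; rewrite uE subgraded_val0.
Qed.

Lemma val_gor_maxideal (x : gor_factor) :
  maxideal (aug gor_factor) x -> mG (\val x).
Proof. by rewrite /maxideal /= gor_factor_aug. Qed.

Lemma to_gor_maxideal x : mG x -> maxideal (aug gor_factor) (to_gor x).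
Proof.
rewrite /maxideal /= gor_factor_aug val_to_gor rmorphB /= => ->.
by rewrite (aug_comp (soc1_proj_comp x)) subr0.
Qed.

Lemma to_gor_u_soc : soc (aug gor_factor) (to_gor u).
Proof.
move=> y my; apply: val_inj; rewrite subgraded_valM [RHS]subgraded_val0 val_to_gor_u.
exact: (top_soc us) (val_gor_maxideal my).
Qed.

(** A socle element of the factor is in the socle of G, so it lives in degrees 1 and s; its degree
    one part is fixed by the projection and also killed by it. *)
Lemma gor_factor_soc (x : gor_factor) : soc (aug gor_factor) x ->
  x = (topcoef (\val x))%:A * to_gor u.
Proof.
move=> xs.
have ax : aug G (\val x) = 0.
  have : \val (x * to_gor u) = 0.
    by rewrite xs ?subgraded_val0 //; apply/to_gor_maxideal/u_maxideal.
  rewrite subgraded_valM val_to_gor_u (soc_aug _ (top_soc us)) => /eqP.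
  by rewrite scaler_eq0 => /orP[/eqP//|/eqP].
have vs : socG (\val x).
  (* Split y into its part in the factor, killed by x by assumption, and its projection, on which x
     acts through its zero augmentation. *)
  move=> y my; rewrite -(subrK (soc1_proj y) y) mulrDr.
  rewrite (soc_aug _ (soc1_proj_soc y)) ax scale0r addr0 -val_to_gor -subgraded_valM.
  by rewrite xs ?subgraded_val0 //; apply: to_gor_maxideal.
apply: val_inj; rewrite subgraded_valM subgr_val_alg mulr_algl val_to_gor_u.
have [vE v1] := soc_decomp vs; rewrite -topcoefP.
have := soc1_proj_val x; rewrite soc1_proj_hcomp soc1_proj_id //; last exact: hcompP.
by move=> v10; move: vE; rewrite v10 add0r.
Qed.

Lemma gor_factor_gorenstein : gorenstein (aug gor_factor).
Proof.
split; first exact: artinian_surj (to_ker_surj (pr := soc1_socProj)) G_art.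
apply: subquo_dimE; first exact: zero_ideal.
exists (fun=> to_gor u); split=> [_|x xs|a].
- exact: to_gor_u_soc.
- exists (fun=> (topcoef (\val x))%:A); rewrite big_ord1 /=.
  by rewrite -(gor_factor_soc xs) subrr.
- rewrite big_ord1 (soc_aug _ to_gor_u_soc) => /eqP.
  rewrite scaler_eq0 => /orP[/eqP a0 i|/eqP/to_gor_u_neq0//].
  by rewrite (ord1 i).
Qed.

Let lin_factor := im_alg soc1_socProj.
Let to_lin : {rmorphism G -> lin_factor} := @to_im k G soc1_socProj.

Lemma lin_factor_val (x : lin_factor) : maxideal (aug lin_factor) x ->
  \val x = soc1_proj (\val x).
Proof.
rewrite /maxideal /= subgraded_aug => ax.
by have /eqP /= -> := valP x; rewrite ax scale0r subr0.
Qed.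

Lemma lin_factor_pow2 : ideal_pow (maxideal (aug lin_factor)) 2 = [set 0].
Proof.
have mI := maxideal_rmorph (aug lin_factor).
apply/seteqP; split=> [x|x ->]; last by have [] := ideal_pow_ideal 2 mI.
move=> [n [a [b [aI bI ->]]]]; rewrite /= big1 // => l _.
apply: val_inj; rewrite subgraded_valM [RHS]subgraded_val0 lin_factor_val //.
apply: soc1_proj_soc.
have : ideal_pow (maxideal (aug lin_factor)) 1 (b l) by exact: bI.
rewrite (ideal_pow1 mI).
by rewrite /maxideal /= subgraded_aug.
Qed.

(** The maximal ideal of this factor is the degree one socle, with square zero; if that socle
    vanishes, the factor is k. *)
Lemma lin_factor_loewy :
  loewy (aug lin_factor) = if r == 0%N then 0%N else 1%N.
Proof.
have mI := maxideal_rmorph (aug lin_factor).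
have m1 := ideal_pow1 mI.
case: eqP => [r0|r0]; apply: loewyE.
- move=> /seteqP[/(_ 1 I)] /= one0; have := oner_neq0 lin_factor.
  by rewrite one0 eqxx.
- rewrite m1; apply/seteqP; split=> [x mx|x ->]; last by have [] := mI.
  apply: val_inj; rewrite [RHS]subgraded_val0 lin_factor_val //.
  by apply: (soc1_eq0.2 r0); [apply: soc1_proj_comp | apply: soc1_proj_soc].
- rewrite m1 => m0; apply/r0/soc1_eq0 => x x1 xs.
  have : maxideal (aug lin_factor) (to_lin x).
    rewrite /maxideal /= subgraded_aug /= soc1_proj_id // (aug_comp x1).
    by rewrite scale0r add0r (aug_comp x1).
  rewrite m0 => /(congr1 val); rewrite subgraded_val0 /= soc1_proj_id //.
  by rewrite (aug_comp x1) scale0r add0r.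
- exact: lin_factor_pow2.
Qed.

(** The dimension count, type = (h - t) + 1, is stated additively because subtraction of naturals is
    truncated. *)
Theorem standard_graded_splitting :
  [/\ h.+1 = (t + cmtype (aug G))%N,
      subquo_dim (aug G) (socG `&` ideal_pow mG 2) [set 0] = 1%N
    & exists A B : gradedAlg k,
        [/\ graded_iso G (fibre_product A B),
            gorenstein (aug A) /\ loewy (aug A) = s,
            artinian B,
            ~ gorenstein (aug G) -> loewy (aug B) = 1%N
          & gorenstein (aug G) -> loewy (aug B) = 0%N]].
Proof.
split.
- rewrite /cmtype (subquo_dimE (@zero_ideal G) soc_dim) addnS.
  by have [-> th] := soc_dim_sub; rewrite subnKC.
- exact: subquo_dimE (@zero_ideal G) soc_pow2_dim.
exists gor_factor, lin_factor; have [gor_r r_gor] := gorenstein_gr; split.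
- exact: fibre_splitting.
- by split; [exact: gor_factor_gorenstein | exact: gor_factor_loewy].
- exact: artinian_surj (to_im_surj (pr := soc1_socProj)) G_art.
- by move=> ngor; rewrite lin_factor_loewy; case: eqP => // /r_gor.
- by move=> /gor_r r0; rewrite lin_factor_loewy r0.
Qed.

End SocleOfStandardGraded.

(** * The associated graded ring *)

Section GrTransfer.
Variables (k : fieldType) (Q : localRing k).
Local Notation m := (maxideal (res Q)).
Local Notation "m ^^ n" := (ideal_pow m n) (at level 30).

Let mI : is_ideal m := maxideal_ideal Q.
Let powI n : is_ideal (m ^^ n) := ideal_pow_ideal n mI.

(** For x outside m^i the value is 0, since [rees_mon] discards such x; hence the membership
    hypotheses in what follows. *)
Definition init_form (i : nat) (x : Q) : gr Q := gr_pi (rees_mon i x).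

Lemma init_form_gcomp i x : (m ^^ i) x -> gcomp i (init_form i x).
Proof. by move=> xi; exists x. Qed.

Lemma gr_compP i (y : gr Q) : gcomp i y -> exists2 x, (m ^^ i) x & y = init_form i x.
Proof. by move=> [x xi <-]; exists x. Qed.

Lemma init_form_eq0 i x : (m ^^ i) x -> init_form i x = 0 <-> (m ^^ i.+1) x.
Proof.
move=> xi; rewrite gr_pi0 rees_monE //; split=> [/(_ i)|xi1 j].
  by rewrite coefZ coefXn eqxx mulr1.
rewrite coefZ coefXn; case: eqP => [->|_]; first by rewrite mulr1.
rewrite mulr0; by have [] := powI j.+1.
Qed.

Lemma init_formM i j x y : (m ^^ i) x -> (m ^^ j) y ->
  init_form (i + j) (x * y) = init_form i x * init_form j y.
Proof.
move=> xi yj; have xyij := ideal_powD mI xi yj.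
rewrite /init_form -rmorphM; congr gr_pi; apply: (val_inj : injective (@rees_val _ Q)).
by rewrite rees_valM !rees_monE // -scalerAl -scalerAr scalerA exprD.
Qed.

Lemma init_formD i x y : (m ^^ i) x -> (m ^^ i) y ->
  init_form i (x + y) = init_form i x + init_form i y.
Proof.
move=> xi yi; have [_ D _] := powI i.
rewrite /init_form -rmorphD; congr gr_pi; apply: (val_inj : injective (@rees_val _ Q)).
by rewrite rees_valD !rees_monE ?scalerDl //; apply: D.
Qed.

Lemma init_form0 i : init_form i 0 = 0.
Proof. by apply/init_form_eq0; [have [] := powI i | have [] := powI i.+1]. Qed.

Lemma init_form_sum i n (x : 'I_n -> Q) : (forall l, (m ^^ i) (x l)) ->
  init_form i (\sum_l x l) = \sum_l init_form i (x l).
Proof.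
move=> xi; suff [] : (m ^^ i) (\sum_l x l) /\
  init_form i (\sum_l x l) = \sum_l init_form i (x l) by [].
elim/big_rec2: _ => [|l y z _ [yi yE]].
  by split; [have [] := powI i | rewrite init_form0].
have [_ D _] := powI i; split; first exact: D.
by rewrite init_formD // yE.
Qed.

Lemma init_formZ i a x : (m ^^ i) x -> init_form i (a * x) = res Q a *: init_form i x.
Proof. by move=> xi; rewrite (@init_formM 0 i) //; apply: gr_scale_cst. Qed.

Lemma init_form_comb i n (a x : 'I_n -> Q) : (forall l, (m ^^ i) (x l)) ->
  init_form i (\sum_l a l * x l) = \sum_l res Q (a l) *: init_form i (x l).
Proof.
move=> xi; rewrite init_form_sum => [|l].
  by apply: eq_bigr => l _; apply: init_formZ.
by have [_ _ M] := powI i; apply: M.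
Qed.

(** A relation over k lifts to one in [Q] modulo m^(i+1) through [klift]; its coefficients lie in m,
    so the scalars are zero. *)
Lemma gr_basis i n : is_subquo_dim (res Q) (m ^^ i) (m ^^ i.+1) n ->
  exists E : 'I_n -> gr Q, [/\ forall l, gcomp i (E l),
    forall x : gr Q, gcomp i x -> exists c : 'I_n -> k, x = \sum_l c l *: E l
  & forall c : 'I_n -> k, \sum_l c l *: E l = 0 -> forall l, c l = 0].
Proof.
move=> [e [eI espan efree]]; exists (fun l => init_form i (e l)); split.
- by move=> l; apply: init_form_gcomp.
- move=> _ /gr_compP[y yi ->]; have [a ya] := espan y yi.
  exists (fun l => res Q (a l)); rewrite -init_form_comb //.
  have aI : (m ^^ i) (\sum_l a l * e l).
    by apply: ideal_sum => // l; have [_ _ M] := powI i; apply: M.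
  rewrite -{1}(subrK (\sum_l a l * e l) y) init_formD //; last exact: idealB.
  by have [_ ->] := init_form_eq0 (idealB (powI i) yi aI); rewrite ?add0r.
- move=> c; have -> : \sum_l c l *: init_form i (e l) =
      init_form i (\sum_l klift Q (c l) * e l).
    by rewrite init_form_comb //; apply: eq_bigr => l _; rewrite kliftK.
  rewrite init_form_eq0 => [/efree cl l|]; first by rewrite -(cl l) kliftK.
  by apply: ideal_sum => // l; have [_ _ M] := powI i; apply: M.
Qed.

Lemma gr_std i (x : gr Q) : gcomp i.+1 x ->
  ideal_mul (@gcomp k (gr Q) 1) (gcomp i) x.
Proof.
move=> /gr_compP[y [n [a [b [aI bI ->]]]] ->].
have a1 l : (m ^^ 1) (a l) by rewrite (ideal_pow1 mI).
exists n, (fun l => init_form 1 (a l)), (fun l => init_form i (b l)); split.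
- by move=> l; apply: init_form_gcomp.
- by move=> l; apply: init_form_gcomp (bI l).
- rewrite init_form_sum => [|l]; last exact: ideal_mulM (aI l) (bI l).
  by apply: eq_bigr => l _; rewrite -add1n (init_formM (a1 l) (bI l)).
Qed.

Lemma gr_top s i (x : gr Q) : m ^^ s.+1 = [set 0] -> (s < i)%N ->
  gcomp i x -> x = 0.
Proof.
by move=> ms1 si /gr_compP[y]; rewrite (ideal_pow0 mI ms1 si) => -> ->; apply: init_form0.
Qed.

(** That G_1 kills the initial form of y means that y m is contained in m^(i+2). *)
Lemma gr_soc_comp i (x : gr Q) :
  (forall y, (m ^^ i) y -> (forall z, m z -> (m ^^ i.+2) (y * z)) ->
    (m ^^ i.+1) y) ->
  gcomp i x -> (forall y, gcomp 1 y -> x * y = 0) -> x = 0.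
Proof.
move=> socP /gr_compP[y yi ->] y0; apply/init_form_eq0 => //; apply: socP => // z mz.
have z1 : (m ^^ 1) z by rewrite (ideal_pow1 mI).
rewrite -addn1; apply/init_form_eq0; first exact: ideal_powD.
by rewrite init_formM // y0 //; apply: init_form_gcomp.
Qed.

Lemma gr_artinian s : artinian Q -> m ^^ s.+1 = [set 0] -> artinian (gr Q).
Proof.
move=> artQ ms1; apply: (@graded_artinian _ _ s) => [i x|i].
  exact: gr_top.
have mm a x : m a -> (m ^^ i) x -> (m ^^ i.+1) (a * x) by apply: ideal_mulM.
have [n /gr_basis[E [_ Espan _]]] :=
  artinian_subquo_dim (@res_surj _ Q) (powI i.+1) mm artQ.
by exists n, E.
Qed.

End GrTransfer.

Theorem proposition5p1 (k : fieldType) (Q : localRing k)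
  (Qgor : gorenstein (res Q))
  (Qshort_stretched : short (res Q) \/ stretched (res Q))
  (s : nat) (sE : s = loewy (res Q)) (s_ge3 : (3 <= s)%N) :
  [/\ (edim (res Q))%:Z =
        (hilb (res Q) s.-1)%:Z + (cmtype (aug (gr Q)))%:Z - 1,
      subquo_dim (aug (gr Q))
        (soc (aug (gr Q)) `&` ideal_pow (maxideal (aug (gr Q))) 2)
        [set 0] = 1%N
    & exists A B : gradedAlg k,
        [/\ graded_iso (gr Q) (fibre_product A B),
            gorenstein (aug A) /\ loewy (aug A) = s,
            artinian B,
            (~ gorenstein (aug (gr Q)) -> loewy (aug B) = 1%N) /\
            (gorenstein (aug (gr Q)) -> loewy (aug B) = 0%N)
          & (loewy (aug B) + 1 < s)%N]].
Proof.
have [artQ typeQ] := Qgor; set m := maxideal (res Q).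
have mI : is_ideal m := maxideal_ideal Q.
have rsurj := @res_surj _ Q.
have [ms ms1] : ideal_pow m s <> [set 0] /\ ideal_pow m s.+1 = [set 0].
  case: s sE s_ge3 => // n /esym nE _; exact: loewy_pos.
have socdim := subquo_dim_pos typeQ.
have socE : soc (res Q) = ideal_pow m s := soc_eq_pow rsurj socdim ms ms1.
(* G_s is m^s/0, the socle of [Q], so type 1 makes it a line; its generator plays the role of
   [u]. *)
have [U [Us U_span U_free]] :
    exists U : 'I_1 -> gr Q, [/\ forall l, gcomp s (U l),
      forall x : gr Q, gcomp s x -> exists c : 'I_1 -> k, x = \sum_l c l *: U l
    & forall c : 'I_1 -> k, \sum_l c l *: U l = 0 -> forall l, c l = 0].
  by apply: gr_basis; rewrite ms1 -socE.
have u0 : U ord0 <> 0.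
  move=> U0; have := U_free (fun=> 1); rewrite big_ord1 U0 scaler0.
  by move=> /(_ erefl ord0)/eqP; rewrite oner_eq0.
have u_span (x : gr Q) : gcomp s x -> exists c, x = c *: U ord0.
  by move=> /U_span[c ->]; exists (c ord0); rewrite big_ord1.
have G_soc i (x : gr Q) : (1 < i < s)%N -> gcomp i x ->
    (forall y, gcomp 1 y -> x * y = 0) -> x = 0.
  move=> i_s; apply: gr_soc_comp => y yi ym; have /andP[i1 lis] := i_s.
  (* The short and the stretched case are told apart only here. *)
  case: Qshort_stretched => [m4|strQ].
    exact: soc_gr_short m4 ms socE s_ge3 _ i_s yi ym.
  apply: (soc_gr_principal rsurj ms ms1 lis _ yi ym).
  by apply: stretched_hilb1 => //; rewrite i1 -sE ltnW.
have fin i : exists n, is_subquo_dim (res Q) (ideal_pow m i) (ideal_pow m i.+1) n.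
  apply: (artinian_subquo_dim rsurj (ideal_pow_ideal _ mI) _ artQ) => a x.
  exact: ideal_mulM.
have [h hdim] := fin 1%N; have [t tdim] := fin s.-1.
have [E [E1 E_span E_free]] := gr_basis hdim.
have [F [Fs F_span F_free]] := gr_basis tdim.
have [typeG soc2 [A [B [isoAB gorA artB B1 B0]]]] :=
  standard_graded_splitting s_ge3 (fun i x => @gr_top _ Q s i x ms1) (Us ord0)
    u0 u_span (@gr_std _ Q) G_soc E1 E_span E_free Fs F_span F_free
    (gr_artinian artQ ms1).
split=> //.
  rewrite (edimE ms1 hdim) /hilb (subquo_dimE (ideal_pow_ideal _ mI) tdim).
  by rewrite -PoszD -typeG -addn1 PoszD addrK.
exists A, B; split=> //.
have [gor|ngor] := pselect (gorenstein (aug (gr Q))).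
  by rewrite B0 // (leq_trans _ s_ge3).
by rewrite B1.
Qed.
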